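(* Let $\alpha$ be a positive integer such that $\alpha\equiv1\pmod{q-1}$. There exists a non-zero element $\lambda_\alpha\in\mathbb{F}_q(t,\theta)$ such that $$L(\chi_t,\alpha)=\lambda_\alpha\frac{\widetilde{\pi}^\alpha}{(t-\theta)\,s_{\mathrm{Car}}(t)},$$ where $L(\chi_t,\alpha)=\sum_{a\in A^+}\chi_t(a)a^{-\alpha}$, the identity being one in the field $\mathbb{C}_\infty((t))$, with $t$ an indeterminate.
   Context: Let $q=p^e$ be a power of a prime $p$ ($e>0$), $A=\mathbb{F}_q[\theta]$ with $\theta$ an indeterminate, $K=\mathbb{F}_q(\theta)$, with absolute value $|a|=q^{\deg_\theta a}$, so $|\theta|=q$. Let $K_\infty=\mathbb{F}_q((1/\theta))$ be the completion of $K$, and $\mathbb{C}_\infty$ the completion of an algebraic closure of $K_\infty$. $A^+$ is the set of monic polynomials of $A$. $\chi_t(a)=a(t)$ denotes the result of substituting $t$ for $\theta$ in $a\in A$. The series $L(\chi_t,\alpha)=\sum_{a\in A^+}\chi_t(a)a^{-\alpha}$ is a well-defined element of $K_\infty[[t]]$ (converging for $t\in\mathbb{C}_\infty$ with $\log_q|t|<\alpha$). Carlitz exponential: $e_{\mathrm{Car}}(\eta)=\sum_{n\ge0}\eta^{q^n}/d_n$ for $\eta\in\mathbb{C}_\infty$, where $d_0=1$, $d_i=[i][i-1]^q\cdots[1]^{q^{i-1}}$ and $[i]=\theta^{q^i}-\theta$ for $i>0$. $\widetilde{\pi}$ is a fixed fundamental period of $e_{\mathrm{Car}}$ (a generator of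 the $A$-module $\ker e_{\mathrm{Car}}$), given, for a choice of a $(q-1)$-th root of $-\theta$, by $\widetilde{\pi}=\theta(-\theta)^{1/(q-1)}\prod_{i\ge1}(1-\theta^{1-q^i})^{-1}$. $s_{\mathrm{Car}}(t)=\sum_{i=0}^\infty e_{\mathrm{Car}}(\widetilde{\pi}/\theta^{i+1})t^i=\sum_{n=0}^\infty\frac{\widetilde{\pi}^{q^n}}{d_n(\theta^{q^n}-t)}$, which converges for $|t|<q$. *)

(* Defs.v *)
From HB Require Import structures.
From mathcomp Require Import all_boot all_order all_algebra.
From mathcomp Require Import generic_quotient.
From mathcomp Require Import finmap.
From mathcomp Require Import all_classical all_reals.
From mathcomp Require Import topology normedtype sequences.
From mathcomp.analysis.showcase Require Import summability.

Set Implicit Arguments.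
Unset Strict Implicit.
Unset Printing Implicit Defensive.

Import Order.TTheory GRing.Theory Num.Theory.
Import numFieldNormedType.Exports.

Local Open Scope classical_set_scope.
Local Open Scope ring_scope.

(** * Formal power series and Laurent series *)

(* A record rather than a bare function type: [nat -> C] already carries the
   pointwise product. *)
Record fps (C : Type) := FPS { fps_coef : nat -> C }.

Section FpsTheory.
Variable C : fieldType.
Implicit Types f g h : fps C.

HB.instance Definition _ := gen_eqMixin (fps C).
HB.instance Definition _ := gen_choiceMixin (fps C).

Lemma fpsP f g : fps_coef f =1 fps_coef g -> f = g.
Proof. by case: f g => [f] [g] /= /funext ->. Qed.

Definition fps_zero : fps C := FPS (fun=> 0).
Definition fps_opp f : fps C := FPS (fun n => - fps_coef f n).
Definition fps_add f g : fps C := FPS (fun n => fps_coef f n + fps_coef g n).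
Definition fps_one : fps C := FPS (fun n => (n == 0%N)%:R).
Definition fps_mul f g : fps C :=
  FPS (fun n => \sum_(i < n.+1) fps_coef f i * fps_coef g (n - i)).

Fact fps_addA : associative fps_add.
Proof. by move=> f g h; apply: fpsP => n /=; rewrite addrA. Qed.
Fact fps_addC : commutative fps_add.
Proof. by move=> f g; apply: fpsP => n /=; rewrite addrC. Qed.
Fact fps_add0 : left_id fps_zero fps_add.
Proof. by move=> f; apply: fpsP => n /=; rewrite add0r. Qed.
Fact fps_addN : left_inverse fps_zero fps_opp fps_add.
Proof. by move=> f; apply: fpsP => n /=; rewrite addNr. Qed.

HB.instance Definition _ :=
  GRing.isZmodule.Build (fps C) fps_addA fps_addC fps_add0 fps_addN.

Let trunc N f := \poly_(i < N) fps_coef f i.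

Let fps_mulE N f g n : (n < N)%N ->
  fps_coef (fps_mul f g) n = (trunc N f * trunc N g)`_n.
Proof.
move=> nN; rewrite coefM; apply: eq_bigr => -[i /=]; rewrite ltnS => le_in _.
by rewrite !coef_poly (leq_ltn_trans le_in nN) (leq_ltn_trans (leq_subr _ _) nN).
Qed.

Let trunc_mul N f g n : (n < N)%N ->
  (trunc N (fps_mul f g))`_n = (trunc N f * trunc N g)`_n.
Proof. by move=> nN; rewrite -fps_mulE // coef_poly nN. Qed.

Fact fps_mulC : commutative fps_mul.
Proof. by move=> f g; apply: fpsP => n; rewrite !(@fps_mulE n.+1) // mulrC. Qed.

Fact fps_mulA : associative fps_mul.
Proof.
move=> f g h; apply: fpsP => n; rewrite !(@fps_mulE n.+1) //.
transitivity ((trunc n.+1 f * trunc n.+1 g * trunc n.+1 h)`_n).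
  rewrite -mulrA !coefM; apply: eq_bigr => -[i /= le_in] _.
  by rewrite trunc_mul // ltnS leq_subr.
rewrite [LHS]coefM [RHS]coefM; apply: eq_bigr => -[i /= le_in] _.
by rewrite trunc_mul.
Qed.

Fact fps_mul1 : left_id fps_one fps_mul.
Proof.
move=> f; apply: fpsP => n /=; rewrite big_ord_recl /= mul1r subn0 big1 ?addr0 //.
by move=> i _; rewrite mul0r.
Qed.

Fact fps_mulDl : left_distributive fps_mul fps_add.
Proof.
move=> f g h; apply: fpsP => n /=; rewrite -big_split /=.
by apply: eq_bigr => i _; rewrite mulrDl.
Qed.

Fact fps_one_neq0 : fps_one != fps_zero.
Proof.
apply/eqP => /(congr1 (fun f => fps_coef f 0%N)) /= /eqP.
by rewrite oner_eq0.
Qed.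

HB.instance Definition _ := GRing.Zmodule_isComNzRing.Build (fps C)
  fps_mulA fps_mulC fps_mul1 fps_mulDl fps_one_neq0.

Definition fps_unit : {pred fps C} := fun f => `[< exists g, g * f = 1 >].
Definition fps_inv f : fps C := xget f [set g | g * f = 1].

Fact fps_mulV : {in fps_unit, left_inverse 1 fps_inv *%R}.
Proof.
move=> f /asboolP [g gf1]; rewrite /fps_inv.
by case: xgetP => [h _ //|/(_ g)].
Qed.
Fact fps_unitPl f g : g * f = 1 -> fps_unit f.
Proof. by move=> gf1; apply/asboolP; exists g. Qed.
Fact fps_invr_out : {in [predC fps_unit], fps_inv =1 id}.
Proof.
move=> f /negP nf; rewrite /fps_inv; case: xgetP => // g _ gf1.
by case: nf; apply: fps_unitPl gf1.
Qed.

HB.instance Definition _ := GRing.ComNzRing_hasMulInverse.Build (fps C)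
  fps_mulV fps_unitPl fps_invr_out.

Let fps_order f : f != 0 ->
  exists2 m, fps_coef f m != 0 & forall i, (i < m)%N -> fps_coef f i = 0.
Proof.
move=> f0; have exf : exists n, fps_coef f n != 0.
  apply: contrapT => nex; case/eqP: f0; apply: fpsP => n /=.
  by have [//|fn] := eqVneq (fps_coef f n) 0; case: nex; exists n.
case: (ex_minnP exf) => m fm min_m; exists m => // i lt_im.
have [//|/min_m] := eqVneq (fps_coef f i) 0.
by rewrite leqNgt lt_im.
Qed.

Fact fps_mulf_eq0 : GRing.integral_domain_axiom (fps C).
Proof.
move=> f g fg0; have [//|/fps_order[m fm minf]] := eqVneq f 0.
have [//|/fps_order[n gn ming]] /= := eqVneq g 0.
have /eqP := congr1 (fun h => fps_coef h (m + n)%N) fg0.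
have lt_m : (m < (m + n).+1)%N by rewrite ltnS leq_addr.
rewrite /= (bigD1 (Ordinal lt_m)) //= addKn big1 ?addr0.
  by rewrite mulf_eq0 (negPf fm) (negPf gn).
move=> [i lt_i]; rewrite -val_eqE /= neq_ltn => /orP[/minf->|lt_mi].
  by rewrite mul0r.
by rewrite ming ?mulr0 // ltn_subLR ?ltn_add2r // -ltnS.
Qed.

HB.instance Definition _ :=
  GRing.ComUnitRing_isIntegral.Build (fps C) fps_mulf_eq0.

Definition fpsC (c : C) : fps C := FPS (fun n => if n == 0%N then c else 0).
Definition fps_of_poly (p : {poly C}) : fps C := FPS (fun n => p`_n).

End FpsTheory.

(* C((t)), realized as the fraction field of C[[t]] *)
Notation laurent C := {fraction (fps C)}.

Definition frac_map (D : idomainType) (E : fieldType) (f : D -> E)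
    (x : {fraction D}) : E :=
  f (\n_(repr x)) / f (\d_(repr x)).

(* independence of the chosen representative *)
Lemma frac_mapE (D : idomainType) (E : fieldType) (f : {rmorphism D -> E})
    (n d : D) : injective f -> d != 0 ->
  frac_map f (FracField.tofrac n / FracField.tofrac d) = f n / f d.
Proof.
move=> f_inj d0; set x := (X in frac_map f X).
have fnz y : y != 0 -> f y != 0 by move=> y0; rewrite -(rmorph0 f) (inj_eq f_inj).
have dx0 := denom_ratioP (repr x).
have xE : FracField.tofrac (\n_(repr x)) / FracField.tofrac (\d_(repr x)) = x.
  rewrite -[RHS]reprK; unlock FracField.tofrac.
  rewrite -[X in _ * X]FracField.pi_inv -[LHS]FracField.pi_mul.
  rewrite /FracField.mulf /FracField.invf !numden_Ratio ?oner_eq0 ?mul1r ?mulr1 //.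
  by rewrite Ratio_numden.
rewrite /frac_map; apply/eqP.
rewrite eqr_div ?fnz // -!rmorphM (inj_eq f_inj) -tofrac_eq !tofracM.
by rewrite -eqr_div ?tofrac_eq0 // xE.
Qed.

(** * Valued fields *)

Section ValuedField.
Variable R : realType.

Definition absolute_value (L : fieldType) (abs : L -> R) : Prop :=
  [/\ forall x, 0 <= abs x,
      forall x, abs x = 0 <-> x = 0,
      forall x y, abs (x * y) = abs x * abs y
    & forall x y, abs (x + y) <= Num.max (abs x) (abs y)].

Section Limits.
Variables (L : fieldType) (abs : L -> R).

Definition abs_cvg (I : Type) (F : set_system I) (u : I -> L) (l : L) : Prop :=
  abs (u i - l) @[i --> F] --> (0 : R).

(* 0 by convention when there is no limit *)
Definition abs_lim (I : Type) (F : set_system I) (u : I -> L) : L :=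
  xget 0 [set l | abs_cvg F u l].

Definition abs_cauchy (u : nat -> L) : Prop :=
  forall e : R, 0 < e ->
    exists N, forall m n, (N <= m)%N -> (N <= n)%N -> abs (u m - u n) < e.

Definition abs_complete : Prop :=
  forall u : nat -> L, abs_cauchy u -> exists l, abs_cvg \oo u l.

(* unordered sum: limit of the sums over the finite subsets of I *)
Definition abs_sum (I : choiceType) (u : I -> L) : L :=
  abs_lim totally (partial_sum u).

End Limits.

Definition isometric (k L : fieldType) (abs_k : k -> R) (abs_L : L -> R)
    (f : {rmorphism k -> L}) : Prop :=
  forall x, abs_L (f x) = abs_k x.

Definition is_completion (k L : fieldType) (abs_k : k -> R) (abs_L : L -> R)
    (f : {rmorphism k -> L}) : Prop :=
  [/\ isometric abs_k abs_L f,
      forall (y : L) (e : R), 0 < e -> exists x, abs_L (y - f x) < e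
    & abs_complete abs_L].

Definition is_algebraic_closure (k : fieldType) (L : closedFieldType)
    (f : {rmorphism k -> L}) : Prop :=
  forall y : L, algebraicOver f y.

(* |n / d| = q ^ (deg n - deg d), where size = deg + 1 on nonzero polynomials *)
Definition ratfun_abs (Fq : finFieldType) (x : {fraction {poly Fq}}) : R :=
  if x == 0 then 0
  else #|Fq|%:R ^+ size (\n_(repr x)) / #|Fq|%:R ^+ size (\d_(repr x)).

(* The completion of an algebraic closure of the completion of Fq(theta), with
   the absolute values extending the one of Fq(theta). These data are unique up
   to isometric isomorphism. *)
Record Cinfty (Fq : finFieldType) := MkCinfty {
  Kinf : fieldType;
  Kinf_abs : Kinf -> R;
  Kinf_abs_axiom : absolute_value Kinf_abs;
  to_Kinf : {rmorphism {fraction {poly Fq}} -> Kinf};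
  Kinf_completion : is_completion (@ratfun_abs Fq) Kinf_abs to_Kinf;

  Kbar : closedFieldType;
  Kbar_abs : Kbar -> R;
  Kbar_abs_axiom : absolute_value Kbar_abs;
  to_Kbar : {rmorphism Kinf -> Kbar};
  Kbar_closure : is_algebraic_closure to_Kbar;
  Kbar_isometric : isometric Kinf_abs Kbar_abs to_Kbar;

  Cinf :> fieldType;
  Cinf_abs : Cinf -> R;
  Cinf_abs_axiom : absolute_value Cinf_abs;
  to_Cinf : {rmorphism Kbar -> Cinf};
  Cinf_completion : is_completion Kbar_abs Cinf_abs to_Cinf
}.

End ValuedField.

(** * The Carlitz period and the function s_Car *)

Section Carlitz.
Variables (R : realType) (Fq : finFieldType) (C : Cinfty R Fq).

Local Notation q := #|Fq|.
Local Notation lim u := (abs_lim (@Cinf_abs R Fq C) \oo u).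

(* the inclusion of A = Fq[theta], theta being the variable of {poly Fq} *)
Definition polyA (a : {poly Fq}) : C :=
  to_Cinf C (to_Kbar C (to_Kinf C (FracField.tofrac a))).

Definition theta : C := polyA 'X.

Definition car_bracket (i : nat) : C := theta ^+ (q ^ i) - theta.

Definition car_d (n : nat) : C :=
  \prod_(j < n) car_bracket (n - j) ^+ (q ^ j).

Definition e_Car (eta : C) : C :=
  lim (series (fun n => eta ^+ (q ^ n) / car_d n)).

(* the fundamental period attached to a (q-1)-th root rho of - theta *)
Definition car_period (rho : C) : C :=
  theta * rho *
  lim (fun n => \prod_(1 <= i < n) (1 - theta ^ (1 - (q ^ i)%N%:Z))^-1).

Definition s_Car (pi : C) : fps C :=
  FPS (fun i => e_Car (pi / theta ^+ i.+1)).

(* chi_t(a) = a(t); the coefficients of a lie in Fq *)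
Definition chi_t (a : {poly Fq}) : fps C :=
  fps_of_poly (map_poly (fun c : Fq => polyA c%:P) a).

(* The sum over monic a of chi_t(a) a^-alpha, for coefficientwise convergence *)
Definition L_chi_t (alpha : nat) : fps C :=
  FPS (fun i => abs_sum (@Cinf_abs R Fq C)
    (fun a : {a : {poly Fq} | a \is monic} =>
       fps_coef (chi_t (val a) * fpsC (polyA (val a) ^- alpha)) i)).

Local Notation "f %:L" := (FracField.tofrac f : laurent C).

Definition laurent_t : laurent C := (fps_of_poly 'X)%:L.
Definition laurentC (c : C) : laurent C := (fpsC c)%:L.
Definition laurent_of_fps (f : fps C) : laurent C := f%:L.

(* Fq(t, theta) = Frac(Fq[theta][t]), embedded in C((t)): the outer variable
   of {poly {poly Fq}} is t and the inner one is theta. *)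
Definition ratfun2 : fieldType := {fraction {poly {poly Fq}}}.
Definition laurent_of_ratfun2 : ratfun2 -> laurent C :=
  frac_map (fun P : {poly {poly Fq}} => (fps_of_poly (map_poly polyA P))%:L).

End Carlitz.

(* Main.v *)
From HB Require Import structures.
Require Import Defs.
From mathcomp Require Import all_boot all_order all_algebra.
From mathcomp Require Import fingroup pgroup abelian finfield.
From mathcomp Require Import qpoly generic_quotient finmap.
From mathcomp Require Import all_classical all_reals.
From mathcomp Require Import topology normedtype sequences.
From mathcomp.analysis.showcase Require Import summability.

Set Implicit Arguments.
Unset Strict Implicit.
Unset Printing Implicit Defensive.

Import Order.TTheory GRing.Theory Num.Theory.
Import numFieldNormedType.Exports.
Local Open Scope classical_set_scope.
Local Open Scope ring_scope.

(* Write x_k = theta^(q^k). Since a^(q^k) = a(x_k), Lagrange interpolation at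
   the nodes x_0, x_1, ... produces, for every d, F_q-linear polynomials in z:
   e(z) = sum_(k <= d) c_(d,k) z^(q^k), where c_(d,k) is the quotient of
   prod_(1 <= j <= d) (x_0 - x_j) by prod_(j <= d, j <> k) (x_k - x_j), vanishes
   at all a of degree < d, and
   P(z) = sum_(k < d) (prod_(j < d, j <> k) (t - x_j) / (x_k - x_j)) z^(q^k)
   takes the value a(t) at those a. The partial fraction expansion of P / e is a
   recurrence for S_n = sum_(a <> 0, deg a < d) a(t) a^-n in terms of the
   coefficients of P and e. As d grows, c_(d,k) tends to pi^(q^k - 1) / d_k by
   the product formula for pi, so that - pi sum_(k < d) c_(d-1,k) / (t - x_k)
   tends to s_Car. This sum is a constant divided by prod_(j < d) (t - x_j),
   hence its products with the coefficients of P have only one pole each. In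
   the limit s_Car * S_n is pi^n times a rational function for every n > 0,
   while S_n tends to - L(chi_t, n) when n = 1 mod q - 1. *)

(** * Interpolation and partial fractions *)

Section Interpolation.
Variables (F : fieldType) (x : nat -> F).
Hypothesis x_inj : injective x.

Definition node_prod d k := \prod_(j < d.+1 | j != k :> nat) (x k - x j).
Definition node_poly d k := \prod_(j < d.+1 | j != k :> nat) ('X - (x j)%:P).

Lemma node_prod_neq0 d k : node_prod d k != 0.
Proof.
by apply/prodf_neq0 => j; rewrite subr_eq0 (inj_eq x_inj) eq_sym.
Qed.

Lemma interpolation d (p : {poly F}) : (size p <= d.+1)%N ->
  p = \sum_(k < d.+1) (p.[x k] / node_prod d k) *: node_poly d k.
Proof.
move=> /(lagrange_gen (ltn0Sn d) x_inj) {1}->.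
apply: eq_bigr => k _; rewrite lagrangeE // mulrA -polyCM mul_polyC.
congr (_ / _ *: _); rewrite horner_prod.
by apply: eq_bigr => j _; rewrite hornerXsubC.
Qed.

Lemma node_poly_lead d (k : 'I_d.+1) : (node_poly d k)`_d = 1.
Proof.
have m : node_poly d k \is monic by apply: monic_prod => j _; apply: monicXsubC.
suff sz : size (node_poly d k) = d.+1 by rewrite -(monicP m) lead_coefE sz.
rewrite size_prod => [|j _]; last by rewrite polyXsubC_eq0.
rewrite (eq_bigr (fun=> (2 * 1)%N)) => [|j _]; last by rewrite size_XsubC.
by rewrite -big_distrr /= sum1_card cardC1 card_ord mul2n -addnn -addSn addnK.
Qed.

(** Compare coefficients of degree [d] in Lagrange's formula, whose basis polynomials are monic of
    degree [d]. The sum therefore vanishes when [size p <= d]. *)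
Lemma divided_difference d (p : {poly F}) : (size p <= d.+1)%N ->
  \sum_(k < d.+1) p.[x k] / node_prod d k = p`_d.
Proof.
move=> szp; rewrite [in RHS](interpolation szp) coef_sum.
by apply: eq_bigr => k _; rewrite coefZ node_poly_lead mulr1.
Qed.

End Interpolation.

Section PartialFractions.
Variables (F : fieldType) (I : finType) (z : I -> F).
Hypothesis z_inj : injective z.

(* Since [e' = 1], the cofactors [e / ('X - z i)] are the Lagrange basis at the
   points [z i]; their coefficients are read off by long division. *)
Lemma power_sum_recurrence (e P : {poly F}) m :
    (forall i, root e (z i)) -> (size e <= #|I|.+1)%N -> e^`() = 1 ->
    (size P <= #|I|)%N -> P.[0] = 0 ->
  P`_m = - \sum_(j < m.+1)
     e`_j * \sum_(i | z i != 0) P.[z i] / z i ^+ (m.+1 - j).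
Proof.
move=> e_root sze e'1 szP P0.
pose v i := e %/ ('X - (z i)%:P).
have vE i : v i * ('X - (z i)%:P) = e by rewrite divpK // dvdp_XsubCl.
have szv i : (size (v i) <= #|I|)%N.
  rewrite size_divp ?polyXsubC_eq0 // size_XsubC /= subn1.
  by case: (size e) sze.
have v_sample i j : (v i).[z j] = (i == j)%:R.
  have [<-|neq_ij] := eqVneq i j.
    have := congr1 (fun p => p.[z i]) e'1; rewrite -[in LHS](vE i) derivM.
    by rewrite derivXsubC !hornerE subrr mulr0 add0r.
  have /eqP := e_root j; rewrite -(vE i) hornerM hornerXsubC => /eqP.
  by rewrite mulf_eq0 subr_eq0 (inj_eq z_inj) [j == i]eq_sym (negPf neq_ij) orbF
    => /eqP.
have PE : P = \sum_i P.[z i] *: v i.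
  apply/eqP; rewrite -subr_eq0; set D := _ - _.
  have szD : (size D <= #|I|)%N.
    rewrite (leq_trans (size_polyD _ _)) // size_polyN geq_max szP /=.
    apply: (leq_trans (size_sum _ _ _)); apply/bigmax_leqP => i _.
    exact: leq_trans (size_scale_leq _ _) (szv i).
  apply: contraTT szD => D0; rewrite -ltnNge cardE -(size_map z).
  apply: max_poly_roots => //; last by rewrite map_inj_uniq ?enum_uniq.
  apply/allP => _ /mapP[i _ ->]; rewrite rootE !hornerE horner_sum (bigD1 i) //=.
  rewrite hornerZ v_sample eqxx mulr1 big1 ?addr0 ?subrr // => j /negPf ji.
  by rewrite hornerZ v_sample ji mulr0.
have v_coef i : z i != 0 ->
    (v i)`_m = - \sum_(j < m.+1) e`_j / z i ^+ (m.+1 - j).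
  move=> zi0; have eE k : e`_k.+1 = (v i)`_k - z i * (v i)`_k.+1.
    by rewrite -{1}(vE i) mulrBr coefB coefMX coefMC mulrC.
  have e0 : e`_0 = - (z i * (v i)`_0).
    by rewrite -{1}(vE i) mulrBr coefB coefMX coefMC mulrC /= sub0r.
  elim: m => [|m IHm]; first by rewrite big_ord1 e0 subn0 mulNr opprK mulrC mulKf.
  rewrite big_ord_recr /= subSnn eE.
  have -> : \sum_(j < m.+1) e`_j / z i ^+ (m.+2 - j) = - (v i)`_m / z i.
    rewrite IHm opprK mulr_suml; apply: eq_bigr => j _.
    by rewrite subSn ?(ltnW (ltn_ord j)) // exprSr invfM mulrA.
  by rewrite expr1 mulrBl mulNr addKr opprK mulrC mulKf.
rewrite {1}PE coef_sum -sumrN; under eq_bigr do rewrite coefZ.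
under [RHS]eq_bigr do rewrite mulr_sumr -sumrN; rewrite exchange_big /=.
(* A root [z i = 0] contributes nothing because [P.[0] = 0]. *)
rewrite [LHS](bigID (fun i => z i != 0)) /= [X in _ + X]big1 ?addr0 => [|i].
  apply: eq_bigr => i zi0; rewrite v_coef // mulrN sumrN mulr_sumr.
  by congr (- _); apply: eq_bigr => j _; rewrite mulrCA.
by rewrite negbK => /eqP ->; rewrite P0 mul0r.
Qed.

End PartialFractions.

(** * Carlitz polynomials *)

Section CarlitzPolynomials.
Variables (Fq : finFieldType) (L : fieldType) (f : {rmorphism {poly Fq} -> L}).
Hypothesis f_inj : injective f.
Local Notation q := #|Fq|.

Definition twist (a : {poly Fq}) : {poly L} :=
  map_poly (fun c : Fq => f c%:P) a.
Definition carlitz_node k := f 'X ^+ (q ^ k).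
Local Notation x := carlitz_node.

Lemma card_field_gt1 : (1 < q)%N.
Proof. exact: finNzRing_gt1. Qed.

Lemma carlitz_node_inj : injective x.
Proof.
move=> j k /eqP; rewrite /carlitz_node -!rmorphXn /= (inj_eq f_inj) => /eqP.
move/(congr1 (size : {poly Fq} -> nat))/eqP.
by rewrite !size_polyXn eqSS (eqn_exp2l _ _ card_field_gt1) => /eqP.
Qed.

Lemma card_pchar_pow :
  exists p n, [/\ p \in [pchar L], (0 < n)%N & q = (p ^ n)%N].
Proof.
have [p pr_p pcharFp] := finPcharP Fq; exists p.
have /p_natP[n qE] : p.-nat q.
  by have := abelem_pgroup (fin_ring_pchar_abelem pcharFp); rewrite pgroupE cardsT.
exists n; split=> //.
  exact: (rmorph_pchar (f \o @polyC Fq : {rmorphism Fq -> L}) pcharFp).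
by case: n qE card_field_gt1 => // ->.
Qed.

Lemma pnat_card_exp k : [pchar L].-nat (q ^ k)%N.
Proof.
have [p [n [pL _ ->]]] := card_pchar_pow.
by rewrite (eq_pnat _ (pcharf_eq pL)) -expnM pnatX pnat_id ?(pcharf_prime pL).
Qed.

Lemma frobeniusD k (a b : L) :
  (a + b) ^+ (q ^ k) = a ^+ (q ^ k) + b ^+ (q ^ k).
Proof. exact: exprDn_pchar (pnat_card_exp k). Qed.

Lemma frobeniusB k (a b : L) :
  (a - b) ^+ (q ^ k) = a ^+ (q ^ k) - b ^+ (q ^ k).
Proof. by rewrite -[in RHS](subrK b a) [in RHS]frobeniusD addrK. Qed.

Lemma frobeniusN k (a : L) : (- a) ^+ (q ^ k) = - a ^+ (q ^ k).
Proof.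
rewrite -[- a]add0r frobeniusB expr0n gtn_eqF ?sub0r //.
by rewrite expn_gt0 (ltnW card_field_gt1).
Qed.

Lemma card_exp_natr k : (0 < k)%N -> (q ^ k)%:R = 0 :> L.
Proof.
move=> k0; have [p [n [pL n0 ->]]] := card_pchar_pow.
by rewrite -expnM natrX pcharf0 // expr0n muln_eq0 !gtn_eqF.
Qed.

(** The [q ^ k]-th power is additive and fixes the images of the constants, so it only raises the
    variable to that power. *)
Lemma twistE a k : f a ^+ (q ^ k) = (twist a).[x k].
Proof.
pose g := (f \o @polyC Fq : {rmorphism Fq -> L}).
rewrite -[twist a]/(map_poly g a).
elim/poly_ind: a => [|a c IHa].
  by rewrite !rmorph0 expr0n expn_eq0 gtn_eqF ?(ltnW card_field_gt1) //= horner0.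
rewrite !rmorphD !rmorphM /= frobeniusD exprMn IHa map_polyX map_polyC /= !hornerE.
rewrite -rmorphXn -polyC_exp; congr (_ + f _%:P).
by elim: k {IHa} => [|k IHk]; rewrite ?expr1 // expnS exprM expf_card.
Qed.

Definition carlitz_coef d k := node_prod x d 0 / node_prod x d k.
(** For injective [f] this is z times the product of 1 - z / [f a] over the nonzero a of degree < d;
    the scaling of [carlitz_coef] makes the linear coefficient 1. *)
Definition carlitz_poly d := \sum_(k < d.+1) carlitz_coef d k *: 'X^(q ^ k).
(** The coefficient of t^i in the polynomial P(z) of the overview, for the nodes x_0, ..., x_d.
    Taking one power of t at a time keeps the coefficients in [L]. *)
Definition interp_poly d i :=
  \sum_(k < d.+1) ((node_poly x d k)`_i / node_prod x d k) *: 'X^(q ^ k).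

Lemma carlitz_coef0 d : carlitz_coef d 0 = 1.
Proof.
by rewrite /carlitz_coef divff ?node_prod_neq0 //; apply: carlitz_node_inj.
Qed.

Lemma size_twist (a : {poly Fq}) : (size (twist a) <= size a)%N.
Proof. exact: size_poly. Qed.

(** By [twistE] the value at [f a] is a multiple of the divided difference of [twist a] at [d.+1]
    nodes, that is, of its coefficient of degree [d], which is zero. *)
Lemma carlitz_poly_root d (a : {poly Fq}) : (size a <= d)%N -> root (carlitz_poly d) (f a).
Proof.
move=> sza; have szt := leq_trans (size_twist a) sza.
rewrite rootE horner_sum; under eq_bigr do
  rewrite hornerZ hornerXn twistE mulrAC -mulrA.
rewrite -mulr_sumr divided_difference ?(leq_trans szt) //.
  by rewrite nth_default ?mulr0.
exact: carlitz_node_inj.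
Qed.

Lemma horner_interp_poly d i (a : {poly Fq}) : (size a <= d.+1)%N ->
  (interp_poly d i).[f a] = (twist a)`_i.
Proof.
move=> sza; have szt := leq_trans (size_twist a) sza.
rewrite [in RHS](interpolation carlitz_node_inj szt) coef_sum horner_sum.
apply: eq_bigr => k _; rewrite hornerZ hornerXn coefZ twistE.
by rewrite mulrC mulrA [RHS]mulrAC.
Qed.

Lemma size_sum_qpow d (u : nat -> L) :
  (size (\sum_(k < d.+1) u k *: 'X^(q ^ k))%R <= (q ^ d).+1)%N.
Proof.
apply: (leq_trans (size_sum _ _ _)); apply/bigmax_leqP => k _.
apply: (leq_trans (size_scale_leq _ _)); rewrite size_polyXn ltnS.
by rewrite leq_exp2l ?card_field_gt1 // -ltnS.
Qed.

Lemma coef_sum_qpow d (u : nat -> L) m :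
  (\sum_(k < d.+1) u k *: 'X^(q ^ k))`_m =
  \sum_(k < d.+1 | (q ^ k == m)%N) u k.
Proof.
rewrite coef_sum [RHS]big_mkcond; apply: eq_bigr => k _.
by rewrite coefZ coefXn eq_sym; case: eqP; rewrite ?mulr1 ?mulr0.
Qed.

Lemma deriv_carlitz_poly d : (carlitz_poly d)^`() = 1.
Proof.
rewrite raddf_sum big_ord_recl /= big1 => [|k _].
  by rewrite derivZ carlitz_coef0 expn0 derivX scale1r addr0.
by rewrite derivZ derivXn -scaler_nat card_exp_natr // scale0r scaler0.
Qed.

Definition power_sum d n i :=
  \sum_(a : {poly_d Fq} | a != 0) (twist a)`_i / f a ^+ n.

(** The partial fraction recurrence at the q^(d+1) points [f a], deg a <= d. They are the roots of
    [carlitz_poly d.+1] and the points where [interp_poly d i] interpolates, hence the shift between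
    the two indices. *)
Lemma power_sum_carlitz d i m : (interp_poly d i)`_m =
  - \sum_(j < m.+1) (carlitz_poly d.+1)`_j * power_sum d.+1 (m.+1 - j) i.
Proof.
pose z (a : {poly_(d.+1) Fq}) := f a.
have z_inj : injective z by move=> a b /f_inj/val_inj.
have z0 a : (z a != 0) = (a != 0) by rewrite -(rmorph0 f) (inj_eq f_inj).
rewrite (@power_sum_recurrence _ _ z z_inj (carlitz_poly d.+1)).
- congr (- _); apply: eq_bigr => j _; congr (_ * _); apply: eq_big => // a _.
  by rewrite horner_interp_poly ?size_npoly.
- by move=> a; apply: carlitz_poly_root; apply: size_npoly.
- by rewrite card_npoly size_sum_qpow.
- exact: deriv_carlitz_poly.
- rewrite card_npoly.
  apply: leq_trans (size_sum_qpow _ (fun k => (node_poly x d k)`_i / node_prod x d k)) _.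
  by rewrite ltn_exp2l ?card_field_gt1.
- have := @horner_interp_poly d i 0 _.
  by rewrite size_poly0 rmorph0 /twist map_poly0 coef0 => ->.
Qed.

End CarlitzPolynomials.

(** * Limits in ultrametric fields *)

Section AbsoluteValue.
Variables (R : realType) (L : fieldType) (abs : L -> R).
Hypothesis absP : absolute_value abs.

Lemma av_ge0 x : 0 <= abs x. Proof. by case: absP. Qed.
Lemma av_eq0 x : abs x = 0 <-> x = 0. Proof. by case: absP. Qed.
Lemma avM x y : abs (x * y) = abs x * abs y. Proof. by case: absP. Qed.
Lemma avD x y : abs (x + y) <= Num.max (abs x) (abs y). Proof. by case: absP. Qed.

Lemma av0 : abs 0 = 0. Proof. exact/av_eq0. Qed.

Lemma av_gt0 x : x != 0 -> 0 < abs x.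
Proof.
by move=> x0; rewrite lt_neqAle av_ge0 eq_sym andbT; apply: contra x0 => /eqP/av_eq0->.
Qed.

Lemma av1 : abs 1 = 1.
Proof.
have /mulIf : abs 1 != 0 by rewrite gt_eqF ?av_gt0 ?oner_eq0.
by apply; rewrite -avM !mul1r.
Qed.

Lemma avX x n : abs (x ^+ n) = abs x ^+ n.
Proof. by elim: n => [|n IHn]; rewrite ?av1 // !exprS avM IHn. Qed.

Lemma avN x : abs (- x) = abs x.
Proof.
have : abs (- 1) ^+ 2 = 1 by rewrite -avX sqrrN expr1n av1.
move/eqP; rewrite sqrf_eq1 => /orP[|] /eqP e1; first by rewrite -mulN1r avM e1 mul1r.
by have := av_ge0 (- 1); rewrite e1 oppr_ge0 ler10.
Qed.

Lemma avV x : abs x^-1 = (abs x)^-1.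
Proof.
have [->|x0] := eqVneq x 0; first by rewrite invr0 av0 invr0.
have /mulIf : abs x != 0 by rewrite gt_eqF ?av_gt0.
by apply; rewrite -avM !mulVf ?av1 // gt_eqF ?av_gt0.
Qed.

Lemma av_prod (I : Type) (r : seq I) (P : pred I) (F : I -> L) :
  abs (\prod_(i <- r | P i) F i) = \prod_(i <- r | P i) abs (F i).
Proof. exact: (big_morph _ avM av1). Qed.

Lemma avB_lt x y e : abs x < e -> abs y < e -> abs (x - y) < e.
Proof.
by move=> xe ye; apply: (le_lt_trans (avD _ _)); rewrite avN gt_max xe ye.
Qed.

Lemma avD_lt x y e : abs x < e -> abs y < e -> abs (x + y) < e.
Proof. by move=> xe ye; rewrite -[y]opprK avB_lt // avN. Qed.

Lemma avBC x y : abs (x - y) = abs (y - x).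
Proof. by rewrite -avN opprB. Qed.

Lemma av_sum_lt (I : Type) (r : seq I) (P : pred I) (F : I -> L) e :
  0 < e -> (forall i, P i -> abs (F i) < e) -> abs (\sum_(i <- r | P i) F i) < e.
Proof.
move=> e0 Fe; elim/big_ind: _ => //; first by rewrite av0.
by move=> x y; apply: avD_lt.
Qed.

Lemma avD_dominant x y : abs y < abs x -> abs (x + y) = abs x.
Proof.
move=> ltyx; apply/eqP; rewrite eq_le; apply/andP; split.
  by apply: (le_trans (avD _ _)); rewrite ge_max lexx ltW.
rewrite leNgt; apply/negP => lt_x; have := avB_lt lt_x ltyx.
by rewrite addrK ltxx.
Qed.

Local Notation "u ~~> l" := (abs_cvg abs \oo u l) (at level 70).

Lemma acvgP (u : nat -> L) l : u ~~> l <->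
  forall e, 0 < e -> exists N, forall n, (N <= n)%N -> abs (u n - l) < e.
Proof.
split=> [/cvgrPdist_lt ul e /ul[N _ Nul]|ul].
  by exists N => n /Nul; rewrite /= sub0r normrN ger0_norm ?av_ge0.
apply/cvgrPdist_lt => e /ul[N Nul]; exists N => // n /= /Nul.
by rewrite sub0r normrN ger0_norm ?av_ge0.
Qed.

Lemma acvg_unique u l1 l2 : u ~~> l1 -> u ~~> l2 -> l1 = l2.
Proof.
move=> /acvgP u1 /acvgP u2; apply/eqP; rewrite -subr_eq0; apply/negPn/negP.
move=> /av_gt0 e0; have [N1 h1] := u1 _ e0; have [N2 h2] := u2 _ e0.
have := avB_lt (h2 _ (leq_maxr N1 N2)) (h1 _ (leq_maxl N1 N2)).
by rewrite opprB addrC addrA subrK ltxx.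
Qed.

Lemma acvg_lim u l : u ~~> l -> abs_lim abs \oo u = l.
Proof.
move=> ul; rewrite /abs_lim; case: xgetP => [l' _ ul'|/(_ l)//].
exact: acvg_unique ul' ul.
Qed.

Lemma acvg_cst c : (fun=> c) ~~> c.
Proof. by apply/acvgP => e e0; exists 0%N => n _; rewrite subrr av0. Qed.

Lemma acvg_eventually u v l N :
  (forall n, (N <= n)%N -> u n = v n) -> v ~~> l -> u ~~> l.
Proof.
move=> uv /acvgP vl; apply/acvgP => e /vl[N' h]; exists (maxn N N') => n.
by rewrite geq_max => /andP[nN nN']; rewrite uv // h.
Qed.

Lemma acvgN u l : u ~~> l -> (fun n => - u n) ~~> - l.
Proof.
move=> /acvgP ul; apply/acvgP => e /ul[N h]; exists N => n /h.
by rewrite -opprD avN.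
Qed.

Lemma acvgD u v l m : u ~~> l -> v ~~> m -> (fun n => u n + v n) ~~> l + m.
Proof.
move=> /acvgP ul /acvgP vm; apply/acvgP => e e0.
have [N1 h1] := ul _ e0; have [N2 h2] := vm _ e0.
exists (maxn N1 N2) => n; rewrite geq_max => /andP[/h1 n1 /h2 n2].
by rewrite opprD addrACA avD_lt.
Qed.

Lemma acvg_sum (I : Type) (r : seq I) (P : pred I) (u : I -> nat -> L) l :
  (forall i, P i -> u i ~~> l i) ->
  (fun n => \sum_(i <- r | P i) u i n) ~~> \sum_(i <- r | P i) l i.
Proof.
move=> ul; elim: r => [|i r IHr].
  under [X in abs_cvg _ _ X]funext do rewrite big_nil.
  by rewrite big_nil; apply: acvg_cst.
under [X in abs_cvg _ _ X]funext do rewrite big_cons.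
by rewrite big_cons; case: ifP => // Pi; apply: acvgD => //; apply: ul.
Qed.

Lemma acvg_bounded u l : u ~~> l ->
  exists2 M, 0 < M & exists N, forall n, (N <= n)%N -> abs (u n) < M.
Proof.
move=> /acvgP/(_ 1 ltr01)[N h]; exists (Num.max 1 (abs l + 1)).
  by rewrite lt_max ltr01.
exists N => n /h un; rewrite -[u n](subrK l); apply: avD_lt.
  by rewrite lt_max un.
by rewrite lt_max ltrDl ltr01 orbT.
Qed.

Lemma acvgM u v l m : u ~~> l -> v ~~> m -> (fun n => u n * v n) ~~> l * m.
Proof.
move=> /acvgP ul vm; have [M M0 [N hM]] := acvg_bounded vm.
apply/acvgP => e e0; have [N1 h1] := ul (e / M) (divr_gt0 e0 M0).
have l0 : 0 < abs l + 1 by rewrite ltr_wpDl ?av_ge0.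
have [N2 h2] := (acvgP _ _).1 vm (e / (abs l + 1)) (divr_gt0 e0 l0).
exists (maxn N (maxn N1 N2)) => n; rewrite !geq_max => /and3P[/hM nM /h1 n1 /h2 n2].
have -> : u n * v n - l * m = (u n - l) * v n + l * (v n - m).
  by rewrite mulrBl mulrBr addrA subrK.
apply: avD_lt; rewrite avM.
  by rewrite -[e](divfK (lt0r_neq0 M0)) ltr_pM ?av_ge0.
rewrite mulrC -[e](divfK (lt0r_neq0 l0)).
by rewrite ltr_pM ?av_ge0 // ltrDl.
Qed.

Lemma acvgX u l k : u ~~> l -> (fun n => u n ^+ k) ~~> l ^+ k.
Proof.
move=> ul; elim: k => [|k IHk]; first exact: acvg_cst.
rewrite exprS; under [X in abs_cvg _ _ X]funext do rewrite exprS.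
exact: acvgM.
Qed.

Lemma acvg_shift u l k : u ~~> l -> (fun n => u (k + n)%N) ~~> l.
Proof.
move=> /acvgP ul; apply/acvgP => e /ul[N h]; exists N => n Nn.
by apply: h; rewrite (leq_trans Nn) ?leq_addl.
Qed.

Lemma acvg_unshift u l k : (fun n => u (k + n)%N) ~~> l -> u ~~> l.
Proof.
move=> /acvgP ul; apply/acvgP => e /ul[N h]; exists (N + k)%N => n Nn.
rewrite -(subnKC (leq_trans (leq_addl _ _) Nn)); apply: h.
by rewrite leq_subRL ?(leq_trans (leq_addl _ _) Nn) // addnC.
Qed.

Lemma acvg_av u l M : u ~~> l -> 0 < M -> (forall n, abs (u n) = M) -> abs l = M.
Proof.
move=> /acvgP ul M0 uM; have [N /(_ N (leqnn N)) h] := ul M M0.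
have -> : l = u N + (l - u N) by rewrite addrC subrK.
by rewrite avD_dominant uM // avBC.
Qed.

(** A constant absolute value keeps the denominators away from 0; the case of use is the period
    product, of absolute value 1. *)
Lemma acvgV u l M : u ~~> l -> 0 < M -> (forall n, abs (u n) = M) ->
  (fun n => (u n)^-1) ~~> l^-1.
Proof.
move=> ul M0 uM; have lM := acvg_av ul M0 uM.
have l0 : l != 0 by apply/eqP => l0; rewrite l0 av0 in lM; rewrite lM ltxx in M0.
have u0 n : u n != 0.
  by apply/eqP => un; have := uM n; rewrite un av0 => M_0; rewrite M_0 ltxx in M0.
apply/acvgP => e e0; move/acvgP: ul => /(_ (e * (M * M))).
rewrite !mulr_gt0 // => /(_ isT)[N h]; exists N => n /h un.
have -> : (u n)^-1 - l^-1 = (l - u n) / (u n * l).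
  by rewrite mulrBl invfM mulrCA divff // mulr1 mulrA divff // mul1r.
by rewrite avM avV avM uM lM avBC ltr_pdivrMr ?mulr_gt0.
Qed.

Lemma acvg_le u l M : u ~~> l ->
  (exists N, forall n, (N <= n)%N -> abs (u n) <= M) -> abs l <= M.
Proof.
move=> /acvgP ul [N1 uM]; rewrite leNgt; apply/negP => Ml.
have l0 : 0 < abs l.
  by apply: le_lt_trans Ml; apply: le_trans (uM _ (leqnn _)); apply: av_ge0.
have [N2 h] := ul _ l0.
have := avB_lt (le_lt_trans (uM _ (leq_maxl N1 N2)) Ml) (h _ (leq_maxr N1 N2)).
by rewrite opprB addrC subrK ltxx.
Qed.

(** Telescoping from [u N], the strong triangle inequality bounds every difference by the largest
    consecutive one. *)
Lemma ultrametric_cauchy u :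
  (forall e, 0 < e -> exists N, forall n, (N <= n)%N -> abs (u n.+1 - u n) < e) ->
  abs_cauchy abs u.
Proof.
move=> h e e0; have [N hN] := h e e0; exists N => m n Nm Nn.
suff uN k : abs (u (N + k)%N - u N) < e.
  have := avB_lt (uN (m - N)%N) (uN (n - N)%N).
  by rewrite !subnKC // opprB addrA subrK.
elim: k => [|k IHk]; first by rewrite addn0 subrr av0.
rewrite -[u _](subrK (u (N + k)%N)) -addrA addnS; apply: avD_lt => //.
  by rewrite hN // leq_addr.
Qed.

Hypothesis complete : abs_complete abs.

(** An ultrametric form of Tannery's theorem: a series converges once its terms tend to 0, so the
    majorant [M] has to tend to 0 rather than be summable. *)
Lemma acvg_dominated (u : nat -> nat -> L) v (M : nat -> R) :
    (forall k, (fun d => u d k) ~~> v k) ->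
    (forall d k, (k <= d)%N -> abs (u d k) <= M k) ->
    (forall e, 0 < e -> exists N, forall k, (N <= k)%N -> M k < e) ->
  exists l, series v ~~> l /\ (fun d => \sum_(k < d.+1) u d k) ~~> l.
Proof.
move=> uv uM M0.
have vM k : abs (v k) <= M k.
  by apply: acvg_le (uv k) _; exists k => d; apply: uM.
have [l vl] : exists l, series v ~~> l.
  apply: complete; apply: ultrametric_cauchy => e /M0[N h]; exists N => n /h Mn.
  by rewrite /series /= big_nat_recr //= addrAC subrr add0r (le_lt_trans (vM n)).
exists l; split=> //; apply/acvgP => e e0; have [N h] := M0 e e0.
have [N1 h1] := (acvgP _ _).1 vl e e0.
(* The finitely many k < N are handled uniformly in d; for k >= N both [u d k] and [v k] are already
   smaller than e. *)
have [N2 h2] : exists N2, forall d k,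
    (N2 <= d)%N -> (k < N)%N -> abs (u d k - v k) < e.
  elim: N {h} => [|N [N2 h2]]; first by exists 0%N.
  have [N3 h3] := (acvgP _ _).1 (uv N) e e0.
  exists (maxn N2 N3) => d k; rewrite geq_max => /andP[dN2 dN3].
  by rewrite ltnS leq_eqVlt => /predU1P[-> | kN]; [apply: h3 | apply: h2].
exists (maxn N1 N2) => d; rewrite geq_max => /andP[dN1 dN2].
rewrite -(subrK (series v d.+1) (\sum_(_ < _) _)) -addrA; apply: avD_lt.
  rewrite /series /= big_mkord -sumrB; apply: av_sum_lt => // k _.
  have [kN|Nk] := ltnP k N; first exact: h2.
  have Mk := h _ Nk; apply: avB_lt; last exact: le_lt_trans (vM k) Mk.
  by apply: le_lt_trans Mk; apply: uM; rewrite -ltnS.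
by apply: h1; rewrite (leq_trans dN1).
Qed.

(** A finite set containing [D d] only adds terms bounded by [M d], so the sums along [D] and the
    sums over the directed set of all finite subsets have the same limit. *)
Lemma acvg_abs_sum (I : choiceType) (u : I -> L) (D : nat -> {fset I}) (M : nat -> R) :
    (forall d, D d `<=` D d.+1)%fset ->
    (forall d i, i \notin D d -> abs (u i) <= M d) ->
    (forall e, 0 < e -> exists N, forall k, (N <= k)%N -> M k < e) ->
  (fun d => \sum_(i <- D d) u i) ~~> abs_sum abs u.
Proof.
move=> D_sub uM M0.
have tail e d (B : {fset I}) : 0 < e -> M d < e -> (D d `<=` B)%fset ->
    abs (\sum_(i <- B) u i - \sum_(i <- D d) u i) < e.
  move=> e0 Mde /fsubsetP DB.
  rewrite [X in X - _](bigID (fun i => i \in D d)) /= -big_filter.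
  have /(perm_big _) -> : perm_eq [seq i <- B | i \in D d] (D d).
    apply: uniq_perm => [||i]; rewrite ?filter_uniq ?fset_uniq // mem_filter.
    by case: (boolP (i \in D d)) => //= /DB.
  rewrite addrAC subrr add0r; apply: av_sum_lt => // i /uM uid.
  exact: le_lt_trans Mde.
have [l Dl] : exists l, (fun d => \sum_(i <- D d) u i) ~~> l.
  apply: complete; apply: ultrametric_cauchy => e e0.
  by have [N h] := M0 e e0; exists N => n /h Mn; apply: tail.
have totally_proper := @totally_filter I.
have totallyP (v : {fset I} -> L) m : abs_cvg abs totally v m <->
    forall e, 0 < e -> exists A, forall B, (A `<=` B)%fset -> abs (v B - m) < e.
  split=> [/cvgrPdist_lt vm e|vm].
    by move=> /vm[A _ hA]; exists A => B /hA; rewrite /= sub0r normrN ger0_norm ?av_ge0.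
  apply/cvgrPdist_lt => e /vm[A hA]; exists A => // B /hA.
  by rewrite /= sub0r normrN ger0_norm ?av_ge0.
have ul : abs_cvg abs totally (partial_sum u) l.
  apply/totallyP => e e0; have [N1 h1] := M0 e e0.
  have [N2 h2] := (acvgP _ _).1 Dl e e0.
  exists (D (maxn N1 N2)) => B DB; rewrite /partial_sum -(big_seq_fsetE _ _ predT u).
  have := tail e _ B e0 (h1 _ (leq_maxl N1 N2)) DB.
  by move/avD_lt => /(_ _ (h2 _ (leq_maxr N1 N2))); rewrite addrA subrK.
suff -> : abs_sum abs u = l by [].
(* Two limits are compared on a union of finite sets, so the choice made by [abs_lim] can only be
   [l]. *)
rewrite /abs_sum /abs_lim; case: xgetP => [l' _|/(_ l)//] /totallyP ul'.
apply/eqP; rewrite -subr_eq0; apply/negPn/negP => /av_gt0 e0.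
have [A1 h1] := (totallyP _ _).1 ul _ e0; have [A2 h2] := ul' _ e0.
have := avB_lt (h1 _ (fsubsetUl A1 A2)) (h2 _ (fsubsetUr A1 A2)).
by rewrite opprB addrC addrA subrK ltxx.
Qed.

End AbsoluteValue.

(** * Power series and fraction fields *)

Section PowerSeries.
Variable K : fieldType.
Implicit Types f g : fps K.

Lemma fps_coefD f g i : fps_coef (f + g) i = fps_coef f i + fps_coef g i.
Proof. by []. Qed.

Lemma fps_coefN f i : fps_coef (- f) i = - fps_coef f i.
Proof. by []. Qed.

Lemma fps_coef_sum (I : Type) (r : seq I) (P : pred I) (F : I -> fps K) i :
  fps_coef (\sum_(k <- r | P k) F k) i = \sum_(k <- r | P k) fps_coef (F k) i.
Proof. by elim/big_rec2: _ => // k y1 y2 _ <-. Qed.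

Lemma fps_of_poly_is_zmod_morphism : zmod_morphism (@fps_of_poly K).
Proof. by move=> p r; apply: fpsP => i /=; rewrite coefB. Qed.
Lemma fps_of_poly_is_monoid_morphism : monoid_morphism (@fps_of_poly K).
Proof.
split; first by apply: fpsP => i /=; rewrite coef1.
by move=> p r; apply: fpsP => i /=; rewrite coefM.
Qed.
HB.instance Definition _ :=
  GRing.isZmodMorphism.Build _ _ (@fps_of_poly K) fps_of_poly_is_zmod_morphism.
HB.instance Definition _ :=
  GRing.isMonoidMorphism.Build _ _ (@fps_of_poly K) fps_of_poly_is_monoid_morphism.

Lemma fps_of_poly_inj : injective (@fps_of_poly K).
Proof. by move=> p r [] pr; apply/polyP => i; apply: (congr1 (@^~ i) pr). Qed.

Lemma fps_of_polyC (c : K) : fps_of_poly c%:P = fpsC c.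
Proof. by apply: fpsP => i /=; rewrite coefC. Qed.

Lemma fpsC_is_zmod_morphism : zmod_morphism (@fpsC K).
Proof. by move=> a b; rewrite -!fps_of_polyC polyCB rmorphB. Qed.
Lemma fpsC_is_monoid_morphism : monoid_morphism (@fpsC K).
Proof.
by split=> [|a b]; rewrite -!fps_of_polyC ?rmorph1 // polyCM rmorphM.
Qed.
HB.instance Definition _ :=
  GRing.isZmodMorphism.Build _ _ (@fpsC K) fpsC_is_zmod_morphism.
HB.instance Definition _ :=
  GRing.isMonoidMorphism.Build _ _ (@fpsC K) fpsC_is_monoid_morphism.

Lemma fpsC_inj : injective (@fpsC K).
Proof. by move=> a b; rewrite -!fps_of_polyC => /fps_of_poly_inj/polyC_inj. Qed.

Lemma fps_coefCM (c : K) f i : fps_coef (fpsC c * f) i = c * fps_coef f i.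
Proof.
by rewrite /= big_ord_recl /= subn0 big1 ?addr0 // => j _; rewrite mul0r.
Qed.

(* 1 / (t - a) *)
Definition fps_pole (a : K) : fps K := FPS (fun i => - a ^- i.+1).

Lemma fps_poleE a : a != 0 -> fps_pole a * fps_of_poly ('X - a%:P) = 1.
Proof.
move=> a0; rewrite rmorphB /= mulrBr fps_of_polyC [fps_pole a * fpsC a]mulrC.
apply: fpsP => i; rewrite fps_coefD fps_coefN fps_coefCM mulrC.
have -> : fps_coef (fps_of_poly 'X * fps_pole a) i =
    if i is j.+1 then fps_coef (fps_pole a) j else 0.
  case: i => [|j] /=.
    by rewrite big_ord1 coefX mul0r.
  rewrite 2!big_ord_recl /= !coefX mul0r mul1r add0r subn1 big1 ?addr0 // => k _.
  by rewrite coefX mul0r.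
case: i => [|i] /=; first by rewrite expr1 sub0r mulrN opprK divff.
by rewrite mulrN opprK [_ ^+ i.+2]exprS invfM mulVKf // addNr.
Qed.

Lemma fps_pole_neq0 a : a != 0 -> fps_pole a != 0.
Proof.
move=> /fps_poleE; apply: contra_eq_neq => ->.
by rewrite mul0r eq_sym oner_neq0.
Qed.

Variables (R : realType) (abs : K -> R).
Hypothesis absP : absolute_value abs.

Definition fps_cvg (u : nat -> fps K) (l : fps K) : Prop :=
  forall i, abs_cvg abs \oo (fun d => fps_coef (u d) i) (fps_coef l i).
Local Notation "u ~~> l" := (fps_cvg u l) (at level 70).

Lemma fps_cvg_unique u l1 l2 : u ~~> l1 -> u ~~> l2 -> l1 = l2.
Proof.
by move=> u1 u2; apply: fpsP => i; apply: acvg_unique absP _ _ _ (u1 i) (u2 i).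
Qed.

Lemma fps_cvg_eventually u v l N :
  (forall n, (N <= n)%N -> u n = v n) -> v ~~> l -> u ~~> l.
Proof.
by move=> uv vl i; apply: (acvg_eventually absP (N := N)) (vl i) => n /uv ->.
Qed.

Lemma fps_cvgC u l : abs_cvg abs \oo u l -> (fun n => fpsC (u n)) ~~> fpsC l.
Proof. by move=> ul [|i] //=; apply: acvg_cst. Qed.

Lemma fps_cvgN u l : u ~~> l -> (fun n => - u n) ~~> - l.
Proof. by move=> ul i; apply: acvgN. Qed.

Lemma fps_cvgD u v l m : u ~~> l -> v ~~> m -> (fun n => u n + v n) ~~> l + m.
Proof. by move=> ul vm i; apply: acvgD. Qed.

Lemma fps_cvg_sum (I : Type) (r : seq I) (P : pred I) (u : I -> nat -> fps K) l :
  (forall i, P i -> u i ~~> l i) ->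
  (fun n => \sum_(i <- r | P i) u i n) ~~> \sum_(i <- r | P i) l i.
Proof.
move=> ul i; rewrite fps_coef_sum.
under [X in abs_cvg _ _ X]funext do rewrite fps_coef_sum.
by apply: acvg_sum => // k /ul.
Qed.

Lemma fps_cvgM u v l m : u ~~> l -> v ~~> m -> (fun n => u n * v n) ~~> l * m.
Proof.
by move=> ul vm i; apply: acvg_sum => // k _; apply: acvgM.
Qed.

Lemma fps_cvg_cst l : (fun=> l) ~~> l.
Proof. by move=> i; apply: acvg_cst. Qed.

End PowerSeries.

(** * Extension of injective ring morphisms to fraction fields *)

Section FractionFields.
Variables (D : idomainType).

Lemma tofrac_repr (x : {fraction D}) :
  FracField.tofrac (\n_(repr x)) / FracField.tofrac (\d_(repr x)) = x.
Proof.
have d0 := denom_ratioP (repr x); rewrite -[RHS]reprK; unlock FracField.tofrac.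
rewrite -[X in _ * X]FracField.pi_inv -[LHS]FracField.pi_mul.
rewrite /FracField.mulf /FracField.invf !numden_Ratio ?oner_eq0 ?mul1r ?mulr1 //.
by rewrite Ratio_numden.
Qed.

Lemma tofrac_numden (x : {fraction D}) :
  exists a b : D, b != 0 /\ x = FracField.tofrac a / FracField.tofrac b.
Proof.
exists (\n_(repr x)), (\d_(repr x)).
by rewrite tofrac_repr; split=> //; apply: denom_ratioP.
Qed.

Variables (E : fieldType) (f : {rmorphism D -> E}).
Hypothesis f_inj : injective f.

Lemma frac_map_tofrac a : frac_map f (FracField.tofrac a) = f a.
Proof.
have := frac_mapE a f_inj (oner_neq0 D).
by rewrite tofrac1 rmorph1 !divr1.
Qed.

Let f_neq0 a : a != 0 -> f a != 0.
Proof. by rewrite -(inj_eq f_inj) rmorph0. Qed.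

Lemma frac_mapD x y : frac_map f (x + y) = frac_map f x + frac_map f y.
Proof.
have [a [b [b0 ->]]] := tofrac_numden x; have [c [d [d0 ->]]] := tofrac_numden y.
rewrite addf_div ?tofrac_eq0 // -!tofracM -tofracD !frac_mapE ?mulf_neq0 //.
by rewrite addf_div ?f_neq0 // !rmorphD !rmorphM.
Qed.

Lemma frac_mapM x y : frac_map f (x * y) = frac_map f x * frac_map f y.
Proof.
have [a [b [b0 ->]]] := tofrac_numden x; have [c [d [d0 ->]]] := tofrac_numden y.
by rewrite mulf_div -!tofracM !frac_mapE ?mulf_neq0 // mulf_div !rmorphM.
Qed.

Lemma frac_map0 : frac_map f 0 = 0.
Proof. by rewrite -tofrac0 frac_map_tofrac rmorph0. Qed.

Lemma frac_mapN x : frac_map f (- x) = - frac_map f x.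
Proof. by apply/eqP; rewrite -addr_eq0 -frac_mapD addNr frac_map0. Qed.

Lemma frac_mapV x : frac_map f x^-1 = (frac_map f x)^-1.
Proof.
have [->|x0] := eqVneq x 0; first by rewrite invr0 frac_map0 invr0.
have fx0 : frac_map f x != 0.
  apply/eqP => fx; have := frac_mapM x x^-1; rewrite fx mul0r divff //.
  by rewrite -tofrac1 frac_map_tofrac rmorph1 => /eqP; rewrite oner_eq0.
apply: (mulIf fx0); rewrite -frac_mapM !mulVf //.
by rewrite -tofrac1 frac_map_tofrac rmorph1.
Qed.

End FractionFields.

(** * The Carlitz period *)

Section CarlitzAnalysis.
Variables (R : realType) (Fq : finFieldType) (C : Cinfty R Fq).
Local Notation q := #|Fq|.
Local Notation abs := (@Cinf_abs R Fq C).
Local Notation "u ~~> l" := (abs_cvg abs \oo u l) (at level 70).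

Let absP : absolute_value abs := @Cinf_abs_axiom R Fq C.

HB.instance Definition _ := GRing.RMorphism.copy (polyA C)
  (to_Cinf C \o to_Kbar C \o to_Kinf C \o @FracField.tofrac {poly Fq}).

Local Notation x := (carlitz_node (polyA C)).

Lemma cardR_gt1 : 1 < q%:R :> R.
Proof. by rewrite ltr1n card_field_gt1. Qed.

(** The embeddings are isometric, which leaves [ratfun_abs]. The chosen representative of the
    fraction has numerator a times its denominator, so the denominator cancels. *)
Lemma abs_polyA (a : {poly Fq}) : a != 0 -> abs (polyA C a) = q%:R ^+ (size a).-1.
Proof.
move=> a0; rewrite /polyA.
have [iso _ _] := @Cinf_completion R Fq C; rewrite iso.
rewrite (@Kbar_isometric R Fq C).
have [-> _ _] := @Kinf_completion R Fq C.
rewrite /ratfun_abs tofrac_eq0 (negPf a0); set z := FracField.tofrac a.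
have d0 := denom_ratioP (repr z).
have /(canRL (divfK _)) := tofrac_repr z; rewrite tofrac_eq0 => /(_ d0).
rewrite -tofracM => /eqP; rewrite tofrac_eq => /eqP ->; rewrite size_mul //.
move: a0; rewrite -size_poly_gt0; case: (size a) => // s _ /=.
rewrite exprD mulfK //.
by rewrite expf_neq0 // pnatr_eq0 -lt0n (ltnW (card_field_gt1 Fq)).
Qed.

Lemma polyA_inj : injective (polyA C).
Proof.
rewrite /polyA => a b /fmorph_inj/fmorph_inj/fmorph_inj/eqP.
by rewrite tofrac_eq => /eqP.
Qed.

Lemma abs_node k : abs (x k) = q%:R ^+ (q ^ k).
Proof.
by rewrite /carlitz_node avX // abs_polyA ?polyX_eq0 // size_polyX.
Qed.

Lemma node_neq0 k : x k != 0.
Proof.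
rewrite /carlitz_node expf_neq0 // -(rmorph0 (polyA C)) (inj_eq polyA_inj).
by rewrite polyX_eq0.
Qed.

Lemma abs_node_lt j k : (j < k)%N -> abs (x j) < abs (x k).
Proof.
move=> jk; rewrite !abs_node ltr_eXn2l ?cardR_gt1 //.
by rewrite ltn_exp2l // card_field_gt1.
Qed.

Lemma abs_nodeB j k : (j < k)%N -> abs (x j - x k) = abs (x k).
Proof.
by move=> jk; rewrite avBC // avD_dominant // avN // abs_node_lt.
Qed.

(** By Frobenius, [k - j]^(q^j) = x_k - x_j. *)
Lemma car_dE k : car_d C k = \prod_(0 <= j < k) (x k - x j).
Proof.
rewrite /car_d big_mkord; apply: eq_bigr => j _.
rewrite /car_bracket (frobeniusB (polyA C)) -exprM -expnD subnK //.
exact: ltnW.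
Qed.

Lemma car_d_polyA k : exists a, car_d C k = polyA C a.
Proof.
exists (\prod_(0 <= j < k) ('X ^+ (q ^ k) - 'X ^+ (q ^ j))).
rewrite car_dE rmorph_prod; apply: eq_bigr => j _.
by rewrite rmorphB !rmorphXn.
Qed.

Lemma car_d_neq0 k : car_d C k != 0.
Proof.
rewrite car_dE prodf_seq_neq0; apply/allP => j; rewrite mem_index_iota /= => jk.
by rewrite subr_eq0 (inj_eq (carlitz_node_inj polyA_inj)) gtn_eqF.
Qed.

(** This is (-1)^d [d] ... [1], with [j] = theta^(q^j) - theta. *)
Definition ell d := \prod_(1 <= j < d.+1) (x 0 - x j).

(** The nodes below x_k give d_k; those above give x_k - x_(k+i) = (x_0 - x_i)^(q^k). *)
Lemma node_prod_split k d :
  node_prod x (k + d) k = car_d C k * ell d ^+ (q ^ k).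
Proof.
rewrite /node_prod -(big_mkord (fun j => j != k) (fun j => x k - x j)) -addnS.
rewrite (@big_cat_nat _ _ _ k) ?leq_addr //=; congr (_ * _).
  rewrite car_dE big_nat_cond [RHS]big_nat_cond; apply: eq_bigl => j.
  by case: ltnP => //= jk; rewrite ltn_eqF ?andbT.
have lt_k : (k < k + d.+1)%N by rewrite addnS ltnS leq_addr.
rewrite big_ltn_cond // eqxx /=.
rewrite /ell -prodrXl -[k.+1]add1n big_addn addKn.
rewrite big_nat_cond [RHS]big_nat_cond; apply: eq_big => [j|j /andP[/andP[j1 _] _]].
  by case: j => //= j; rewrite addSn gtn_eqF ?andbT // ltnS leq_addl.
rewrite (frobeniusB (polyA C)) /carlitz_node -!exprM -!expnD.
by rewrite add0n.
Qed.

Lemma ellE d : ell d = node_prod x d 0.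
Proof. by rewrite -[d in RHS]add0n node_prod_split /car_d big_ord0 mul1r expn0 expr1. Qed.

End CarlitzAnalysis.

(** * The product formula for the period and the limits of the Carlitz coefficients *)

Section CarlitzPeriod.
Variables (R : realType) (Fq : finFieldType) (C : Cinfty R Fq).
Local Notation q := #|Fq|.
Local Notation abs := (@Cinf_abs R Fq C).
Local Notation "u ~~> l" := (abs_cvg abs \oo u l) (at level 70).
Local Notation x := (carlitz_node (polyA C)).

Let absP : absolute_value abs := @Cinf_abs_axiom R Fq C.

(** A bound of order 1/k is crude but covers all the majorants used below. *)
Lemma vanishing_natr (M : nat -> R) A : (forall k, M k * k%:R <= A) ->
  forall e, 0 < e -> exists N, forall k, (N <= k)%N -> M k < e.
Proof.
move=> MA e e0; have A0 : 0 <= A by have := MA 0%N; rewrite mulr0.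
exists (Num.bound (A / e)) => k Nk.
have Ae : A / e < k%:R.
  by apply: (lt_le_trans (archi_boundP _)); rewrite ?divr_ge0 ?ler_nat // ltW.
have k0 : 0 < k%:R :> R by apply: le_lt_trans Ae; rewrite divr_ge0 // ltW.
rewrite -(ltr_pM2r k0); apply: (le_lt_trans (MA k)).
by rewrite mulrC -ltr_pdivrMr.
Qed.

Lemma natr_le_abs_node k : k%:R <= abs (x k).
Proof.
rewrite abs_node -natrX ler_nat ltnW //.
apply: (ltn_trans (ltn_expl k (card_field_gt1 Fq))).
exact/ltn_expl/card_field_gt1.
Qed.

Lemma abs_node_ge1 k : 1 <= abs (x k).
Proof. by rewrite abs_node exprn_ege1 // ltW // cardR_gt1. Qed.

Definition period_product n : C :=
  \prod_(1 <= i < n) (1 - theta C ^ (1 - (q ^ i)%N%:Z))^-1.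

Lemma theta_node : theta C = x 0.
Proof. by rewrite /carlitz_node expr1. Qed.

Lemma period_factorE i : 1 - theta C ^ (1 - (q ^ i)%N%:Z) = 1 - x 0 / x i.
Proof.
have t0 : theta C != 0 by rewrite theta_node node_neq0.
by rewrite expfzDr // expr1z -invr_expz -exprnP {1}theta_node.
Qed.

Lemma abs_period_term i : (0 < i)%N -> abs (x 0 / x i) < 1.
Proof.
move=> i0; rewrite avM // avV // ltr_pdivrMr ?av_gt0 ?node_neq0 // mul1r.
exact: abs_node_lt.
Qed.

Lemma abs_period_factor i : (0 < i)%N -> abs (1 - x 0 / x i) = 1.
Proof.
by move=> i0; rewrite avD_dominant ?av1 // avN // abs_period_term.
Qed.

Lemma period_factor_neq0 i : (0 < i)%N -> 1 - x 0 / x i != 0.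
Proof.
move=> /abs_period_factor a1; apply/eqP => e0.
by move: a1; rewrite e0 av0 // => /esym/eqP; rewrite oner_eq0.
Qed.

Lemma abs_period_product n : abs (period_product n) = 1.
Proof.
rewrite av_prod // big_nat big1 // => i /andP[i0 _].
by rewrite period_factorE avV // abs_period_factor // invr1.
Qed.

(** The partial products have absolute value 1, so consecutive ones differ by |(1 - y)^-1 - 1| = |y|
    with y = x_0 / x_n, which tends to 0. *)
Lemma period_product_cvg : exists l, period_product ~~> l.
Proof.
have [_ _ complete] := @Cinf_completion R Fq C.
apply: complete; apply: ultrametric_cauchy => // e e0.
have [|N h] := @vanishing_natr (fun k => abs (x 0 / x k)) (abs (x 0)) _ e e0.
  move=> k; rewrite avM // avV // -[leRHS]mulr1 -mulrA ler_wpM2l ?av_ge0 //.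
  by rewrite mulrC ler_pdivrMr ?av_gt0 ?node_neq0 // mul1r natr_le_abs_node.
exists (maxn N 1) => n; rewrite geq_max => /andP[/h nN n0].
rewrite /period_product big_nat_recr //= -/(period_product n) period_factorE.
rewrite -[X in _ - X]mulr1 -mulrBr avM // abs_period_product mul1r.
have -> : (1 - x 0 / x n)^-1 - 1 = (x 0 / x n) / (1 - x 0 / x n).
  have f0 := period_factor_neq0 n0; apply: (mulIf f0); rewrite mulrBl mulVf //.
  by rewrite mulrVK ?unitfE // mul1r opprB addrC subrK.
by rewrite avM // avV // abs_period_factor // invr1 mulr1.
Qed.

(** Each factor is x_0 - x_j = - x_j (1 - x_0 / x_j). The index [d.+1] is needed because
    [period_product n] stops at n - 1. *)
Lemma ell_period_product d :
  ell C d = \prod_(1 <= j < d.+1) (- x j) / period_product d.+1.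
Proof.
rewrite /ell /period_product prodfV invrK -big_split /=.
rewrite big_nat [RHS]big_nat; apply: eq_bigr => i /andP[i0 _].
by rewrite period_factorE mulrBr mulr1 mulNr opprK mulrCA divff ?node_neq0 // mulr1 addrC.
Qed.

Lemma ell_neq0 d : ell C d != 0.
Proof. by rewrite ellE node_prod_neq0 //; apply: carlitz_node_inj; apply: polyA_inj. Qed.

Lemma abs_ell d : abs (ell C d) = \prod_(1 <= j < d.+1) abs (x j).
Proof.
rewrite /ell av_prod // big_nat [RHS]big_nat; apply: eq_bigr => j /andP[j0 _].
exact: abs_nodeB.
Qed.

Lemma carlitz_coefE d k :
  carlitz_coef (polyA C) (k + d) k = ell C (k + d) / (car_d C k * ell C d ^+ (q ^ k)).
Proof. by rewrite /carlitz_coef node_prod_split -ellE. Qed.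

Lemma nodeX j k : x j ^+ (q ^ k) = x (j + k).
Proof. by rewrite /carlitz_node -exprM -expnD. Qed.

(** The uniform bound for dominated convergence. In [ell C d] the factors beyond k match those of
    [ell C (d - k) ^+ (q ^ k)] in absolute value; the first k are at most |x_k| each, and |d_k| =
    |x_k|^k. *)
Lemma abs_carlitz_coef d k : (k <= d)%N -> abs (carlitz_coef (polyA C) d k) <= 1.
Proof.
move=> kd; rewrite -(subnKC kd) carlitz_coefE; set e := (d - k)%N.
rewrite avM // avV // avM // avX // !abs_ell.
have car0 : 0 < abs (car_d C k) by rewrite av_gt0 // car_d_neq0.
rewrite ler_pdivrMr ?mulr_gt0 ?exprn_gt0 //; last first.
  by rewrite -abs_ell av_gt0 // ell_neq0.
rewrite mul1r (@big_cat_nat _ _ _ k.+1) ?ltnS ?leq_addr //=.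
apply: ler_pM.
- by rewrite prodr_ge0 // => j _; rewrite av_ge0.
- by rewrite prodr_ge0 // => j _; rewrite av_ge0.
- rewrite car_dE av_prod // big_add1 /= big_nat [leRHS]big_nat ler_prod // => j jk.
  rewrite av_ge0 //= avBC // abs_nodeB // abs_node abs_node ler_eXn2l ?cardR_gt1 //.
  by rewrite leq_exp2l // card_field_gt1.
- rewrite -prodrXl -[k.+1]add1n big_addn -addnS addKn.
  rewrite le_eqVlt; apply/orP; left; apply/eqP; apply: eq_bigr => j _.
  by rewrite -avX // nodeX.
Qed.

Section Period.
Variable rho : C.
Hypothesis hrho : rho ^+ q.-1 = - theta C.
Local Notation pi := (car_period rho).

Lemma period_neq0 : pi != 0.
Proof.
have t0 : theta C != 0 by rewrite theta_node node_neq0.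
rewrite /car_period !mulf_neq0 //.
  have q1 : (0 < q.-1)%N by have := card_field_gt1 Fq; case: #|Fq| => [|[]].
  by apply: contra_eq_neq hrho => ->; rewrite expr0n gtn_eqF //= eq_sym oppr_eq0.
have [l ul] := period_product_cvg; rewrite (acvg_lim absP ul).
have := acvg_av absP ul ltr01 abs_period_product.
by apply: contra_eq_neq => ->; rewrite av0 // eq_sym oner_neq0.
Qed.

(** For k = 1 the limit is - x_1 l^(q-1), with l the limit of the period product, and (theta
    rho)^(q-1) = - theta^q = - x_1. Induction then writes the ratio for k + 1 as the case k = 1,
    shifted by k, times the q-th power of the ratio for k. *)
Lemma ell_ratio_cvg k :
  (fun d => ell C (k + d) / ell C d ^+ (q ^ k)) ~~> pi ^+ (q ^ k).-1.
Proof.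
have [l ul] := period_product_cvg.
have q0 := ltnW (card_field_gt1 Fq).
have step : (fun d => ell C d.+1 / ell C d ^+ q) ~~> pi ^+ q.-1.
  have -> : pi ^+ q.-1 = - x 1 * (l ^+ q / l).
    have l0 : l != 0.
      have := acvg_av absP ul ltr01 abs_period_product.
      by apply: contra_eq_neq => ->; rewrite av0 // eq_sym oner_neq0.
    rewrite /car_period (acvg_lim absP ul) !exprMn hrho.
    by rewrite -[in l ^+ q](prednK q0) exprSr mulfK // mulrN -exprSr prednK.
  have eq_u d : ell C d.+1 / ell C d ^+ q =
     - x 1 * (period_product d.+1 ^+ q / period_product d.+2).
    rewrite !ell_period_product expr_div_n invf_div mulf_div.
    (* The q-th power shifts the nodes by one, so only - x_1 survives in the quotient. *)
    have -> : (\prod_(1 <= j < d.+1) - x j) ^+ q = \prod_(1 <= j < d.+1) - x j.+1.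
      rewrite -prodrXl; apply: eq_bigr => j _.
      by have := frobeniusN (polyA C) 1 (x j); rewrite nodeX expn1 addn1.
    rewrite big_ltn // big_add1 /=; set p := \prod_(_ <= _ < _) _.
    have p0 : p != 0.
      by rewrite prodf_seq_neq0; apply/allP => j _; rewrite oppr_eq0 node_neq0.
    by rewrite [_ * p * _]mulrAC -mulf_div divff // mulr1 mulrA.
  rewrite (funext eq_u); apply: acvgM => //; first exact: acvg_cst.
  apply: acvgM => //.
    by apply: acvgX => //; apply: (@acvg_shift _ _ _ absP period_product _ 1 ul).
  apply: (acvgV absP (M := 1)) => // [|d]; last exact: abs_period_product.
  exact: (@acvg_shift _ _ _ absP period_product _ 2 ul).
elim: k => [|k IHk].
  have -> : (fun d => ell C (0 + d) / ell C d ^+ (q ^ 0)) = fun=> 1.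
    by apply/funext => d; rewrite expn0 expr1 divff // ell_neq0.
  exact: acvg_cst.
have -> : pi ^+ (q ^ k.+1).-1 = pi ^+ q.-1 * (pi ^+ (q ^ k).-1) ^+ q.
  rewrite -exprM -exprD; congr (_ ^+ _).
  have le_q : (q <= q ^ k.+1)%N by rewrite expnS leq_pmulr // expn_gt0 q0.
  by rewrite -!subn1 mulnBl mul1n -expnSr addnC addnBA // subnK.
have -> : (fun d => ell C (k.+1 + d) / ell C d ^+ (q ^ k.+1)) =
    fun d => ell C (k + d).+1 / ell C (k + d) ^+ q *
             (ell C (k + d) / ell C d ^+ (q ^ k)) ^+ q.
  apply/funext => d; rewrite expr_div_n -exprM -expnSr addSn.
  by rewrite mulrA divfK // expf_neq0 // ell_neq0.
apply: acvgM => //; last exact: acvgX.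
exact: (@acvg_shift _ _ _ absP (fun d => ell C d.+1 / ell C d ^+ q)).
Qed.

(** Thus [carlitz_poly] tends coefficientwise to e_Car(pi z) / pi. *)
Lemma carlitz_coef_cvg k :
  (fun d => carlitz_coef (polyA C) d k) ~~> pi ^+ (q ^ k).-1 / car_d C k.
Proof.
apply: (acvg_unshift absP (k := k)).
have -> : (fun d => carlitz_coef (polyA C) (k + d) k) =
    fun d => ell C (k + d) / ell C d ^+ (q ^ k) * (car_d C k)^-1.
  by apply/funext => d; rewrite carlitz_coefE invfM mulrCA mulrC.
apply: acvgM => //; [exact: ell_ratio_cvg | exact: acvg_cst].
Qed.

End Period.
End CarlitzPeriod.

(** * Limits of the power sums *)

Section SpecialValues.
Variables (R : realType) (Fq : finFieldType) (C : Cinfty R Fq).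
Local Notation q := #|Fq|.
Local Notation abs := (@Cinf_abs R Fq C).
Local Notation "u ~~> l" := (fps_cvg abs u l) (at level 70).
Local Notation x := (carlitz_node (polyA C)).
Local Notation c := (carlitz_coef (polyA C)).

Let absP : absolute_value abs := @Cinf_abs_axiom R Fq C.

Lemma node_inj : injective x.
Proof. exact: carlitz_node_inj (@polyA_inj _ _ C). Qed.

(** Since q^k = m forces k < m, the range of summation can be made independent of d before passing
    to the limit. The condition selects at most one k, and none if m is not a power of q. *)
Lemma ord_sum_qpow (V : nmodType) (u : nat -> V) n m : (m <= n)%N ->
  \sum_(k < n | (q ^ k == m)%N) u k = \sum_(k < m | (q ^ k == m)%N) u k.
Proof.
move=> mn; rewrite [RHS](big_ord_widen_cond n (fun k => q ^ k == m)%N) //.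
apply: eq_bigl => k; case: eqP => //= <-.
by rewrite ltn_expl // card_field_gt1.
Qed.

Section Period.
Variable rho : C.
Hypothesis hrho : rho ^+ q.-1 = - theta C.
Local Notation pi := (car_period rho).

Lemma period_expq k : pi * pi ^+ (q ^ k).-1 = pi ^+ (q ^ k).
Proof. by rewrite -exprS prednK // expn_gt0 (ltnW (card_field_gt1 Fq)). Qed.

(** The sign turns the poles 1 / (t - x_k) into the 1 / (x_k - t) of the expansion of s_Car. *)
Definition s_trunc d : fps C :=
  \sum_(k < d.+1) fpsC (- (pi * c d k)) * fps_pole (x k).

(** Dominated convergence with majorant |pi| / |x_k|, from |c_(d,k)| <= 1 and |x_k| >= 1. *)
Lemma s_trunc_cvg : s_trunc ~~> s_Car pi.
Proof.
move=> i; pose u d k := pi * c d k / x k ^+ i.+1.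
pose v k := pi ^+ (q ^ k) / car_d C k / x k ^+ i.+1.
have -> : (fun d => fps_coef (s_trunc d) i) = fun d => \sum_(k < d.+1) u d k.
  apply/funext => d; rewrite fps_coef_sum; apply: eq_bigr => k _.
  by rewrite fps_coefCM /= mulrNN.
have [_ _ complete] := @Cinf_completion R Fq C.
have [l [vl ul]] : exists l, abs_cvg abs \oo (series v) l /\
    abs_cvg abs \oo (fun d => \sum_(k < d.+1) u d k) l.
  apply: (acvg_dominated absP complete (M := fun k => abs pi / abs (x k))).
  - move=> k; apply: acvgM => //; last exact: acvg_cst.
    rewrite -period_expq -mulrA; apply: acvgM => //; first exact: acvg_cst.
    exact: carlitz_coef_cvg.
  - move=> d k kd; rewrite /u (avM absP) (avM absP pi) (avV absP) (avX absP).
    rewrite -mulrA; apply: ler_wpM2l; first exact: av_ge0.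
    have x1 := abs_node_ge1 C k; have x0 := lt_le_trans ltr01 x1.
    apply: (le_trans (ler_piMl _ (abs_carlitz_coef C kd))).
      by rewrite invr_ge0 exprn_ge0 // ltW.
    by rewrite lef_pV2 ?posrE ?exprn_gt0 // ler_eXnr.
  - apply: (@vanishing_natr _ _ (abs pi)) => k.
    have x0 := lt_le_trans ltr01 (abs_node_ge1 C k).
    rewrite -mulrA ler_piMr ?av_ge0 // mulrC ler_pdivrMr // mul1r.
    exact: natr_le_abs_node.
(* The limit series is the one defining e_Car(pi / theta^(i+1)), term by term. *)
suff -> : fps_coef (s_Car pi) i = l by [].
rewrite -(acvg_lim absP vl) /= /e_Car; congr (abs_lim _ _ (series _)).
apply/funext => k; rewrite /v expr_div_n -exprM mulrAC.
by rewrite /carlitz_node -exprM [(i.+1 * _)%N]mulnC.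
Qed.

(** Interpolating the constant 1 shows that [s_trunc d] times the product of all t - x_j is the
    constant - pi [ell C d]. Leaving out the factor t - x_k leaves one pole. *)
Lemma s_trunc_node_poly d (k : 'I_d.+1) :
  s_trunc d * fps_of_poly (node_poly x d k) =
  fpsC (- (pi * ell C d)) * fps_pole (x k).
Proof.
have poleE j : fps_pole (x j) * fps_of_poly ('X - (x j)%:P) = 1.
  by rewrite fps_poleE ?node_neq0.
pose b := \prod_(j < d.+1) ('X - (x j)%:P).
have bE (j : 'I_d.+1) : b = ('X - (x j)%:P) * node_poly x d j.
  by rewrite /b (bigD1 j).
have Wb : s_trunc d * fps_of_poly b = fpsC (- (pi * ell C d)).
  rewrite mulr_suml.
  have -> : \sum_(j < d.+1) fpsC (- (pi * c d j)) * fps_pole (x j) * fps_of_poly b =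
     fpsC (- (pi * ell C d)) *
       fps_of_poly (\sum_(j < d.+1)
         ((1 : {poly C}).[x j] / node_prod x d j) *: node_poly x d j).
    rewrite rmorph_sum mulr_sumr; apply: eq_bigr => j _.
    rewrite (bE j) rmorphM /= -mulrA [fps_pole _ * _]mulrA poleE mul1r.
    rewrite hornerC -mul_polyC rmorphM /= fps_of_polyC mulrA -rmorphM; congr (fpsC _ * _).
    by rewrite /carlitz_coef -ellE mulNr mul1r mulrA.
  by rewrite -interpolation ?size_poly1 ?rmorph1 ?mulr1 //; apply: node_inj.
rewrite -Wb (bE k) rmorphM /= -mulrA; congr (_ * _).
by rewrite mulrC mulrA poleE mul1r.
Qed.

(** The coefficient of z^m in P(z), as a power series in t. *)
Definition interp_coef d m : fps C :=
  FPS (fun i => (interp_poly (polyA C) d i)`_m).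
Definition power_sum_fps d n : fps C :=
  FPS (fun i => power_sum (polyA C) d n i).

Lemma s_trunc_interp d m : s_trunc d * interp_coef d m =
  \sum_(k < d.+1 | (q ^ k == m)%N) fpsC (- (pi * c d k)) * fps_pole (x k).
Proof.
have -> : interp_coef d m = \sum_(k < d.+1 | (q ^ k == m)%N)
    fpsC (node_prod x d k)^-1 * fps_of_poly (node_poly x d k).
  apply: fpsP => i; rewrite fps_coef_sum; under eq_bigr do rewrite fps_coefCM.
  rewrite /= /interp_poly.
  rewrite (coef_sum_qpow Fq d (fun k => (node_poly x d k)`_i / node_prod x d k)).
  by apply: eq_bigr => k _; rewrite mulrC.
rewrite mulr_sumr; apply: eq_bigr => k _.
rewrite mulrCA s_trunc_node_poly mulrA -rmorphM; congr (fpsC _ * _).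
by rewrite /carlitz_coef -ellE mulrC mulNr mulrA.
Qed.

Lemma power_sum_fps_rec d m :
  power_sum_fps d.+1 m.+1 = - interp_coef d m.+1 -
    \sum_(j < m) fpsC (carlitz_poly (polyA C) d.+1)`_j.+2 * power_sum_fps d.+1 (m - j).
Proof.
apply: fpsP => i; rewrite fps_coefD !fps_coefN fps_coef_sum.
under eq_bigr do rewrite fps_coefCM.
rewrite /=.
rewrite power_sum_carlitz ?opprK; last exact: polyA_inj.
(* The coefficient of z^0 in [carlitz_poly] is 0 and that of z is 1, which isolates the power sum of
   exponent [m.+1]. *)
rewrite 2!big_ord_recl /= !(coef_sum_qpow Fq d.+1 (c d.+1)).
rewrite [X in X * _ + _]big1 ?mul0r ?add0r; last first.
  by move=> k; rewrite expn_eq0 gtn_eqF // (ltnW (card_field_gt1 Fq)).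
rewrite (ord_sum_qpow (c d.+1)) // big_mkcond big_ord1 expn0 eqxx.
rewrite carlitz_coef0 ?mul1r; last exact: polyA_inj.
rewrite subn1 /= -[LHS]addr0 -addrA; congr (_ + _).
apply/eqP; rewrite eq_sym subr_eq0; apply/eqP; exact: eq_bigr.
Qed.

End Period.
End SpecialValues.

(** * Rational functions of t and theta, graded by powers of the period *)

Section Rationality.
Variables (R : realType) (Fq : finFieldType) (C : Cinfty R Fq).
Local Notation q := #|Fq|.
Local Notation x := (carlitz_node (polyA C)).

HB.instance Definition _ := GRing.RMorphism.copy (@laurentC R Fq C)
  (@FracField.tofrac (fps C) \o @fpsC C).

(** The map inside [laurent_of_ratfun2], named so that it can carry a ring morphism structure. *)
Definition ratfun2_poly (P : {poly {poly Fq}}) : laurent C :=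
  FracField.tofrac (fps_of_poly (map_poly (polyA C) P)).
HB.instance Definition _ := GRing.RMorphism.copy ratfun2_poly
  (@FracField.tofrac (fps C) \o @fps_of_poly C \o map_poly (polyA C)).

Lemma ratfun2_poly_inj : injective ratfun2_poly.
Proof.
move=> P Q /eqP; rewrite tofrac_eq => /eqP/fps_of_poly_inj.
exact/map_inj_poly/rmorph0/polyA_inj.
Qed.

Definition is_ratfun2 (z : laurent C) : Prop :=
  exists lam, laurent_of_ratfun2 C lam = z.

Lemma is_ratfun2_poly P : is_ratfun2 (ratfun2_poly P).
Proof. by exists (FracField.tofrac P); apply: frac_map_tofrac ratfun2_poly_inj P. Qed.

Lemma is_ratfun2D y z : is_ratfun2 y -> is_ratfun2 z -> is_ratfun2 (y + z).
Proof. by move=> [a <-] [b <-]; exists (a + b); apply: frac_mapD ratfun2_poly_inj a b. Qed.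

Lemma is_ratfun2M y z : is_ratfun2 y -> is_ratfun2 z -> is_ratfun2 (y * z).
Proof. by move=> [a <-] [b <-]; exists (a * b); apply: frac_mapM ratfun2_poly_inj a b. Qed.

Lemma is_ratfun2N y : is_ratfun2 y -> is_ratfun2 (- y).
Proof. by move=> [a <-]; exists (- a); apply: frac_mapN ratfun2_poly_inj a. Qed.

Lemma is_ratfun2V y : is_ratfun2 y -> is_ratfun2 y^-1.
Proof. by move=> [a <-]; exists a^-1; apply: frac_mapV ratfun2_poly_inj a. Qed.

Lemma is_ratfun2_t : is_ratfun2 (laurent_t C).
Proof. by have := is_ratfun2_poly 'X; rewrite /ratfun2_poly map_polyX. Qed.

Lemma is_ratfun2_polyA a : is_ratfun2 (laurentC (polyA C a)).
Proof.
by have := is_ratfun2_poly a%:P; rewrite /ratfun2_poly map_polyC /= fps_of_polyC.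
Qed.

Lemma tofrac_pole k :
  FracField.tofrac (fps_pole (x k)) = (laurent_t C - laurentC (x k))^-1.
Proof.
have := fps_poleE (node_neq0 C k); rewrite rmorphB /= fps_of_polyC.
move/(congr1 (@FracField.tofrac (fps C))); rewrite tofracM tofracB tofrac1 => pE.
have d0 : laurent_t C - laurentC (x k) != 0.
  by apply: contra_eq_neq pE => ->; rewrite mulr0 eq_sym oner_neq0.
by apply: (mulIf d0); rewrite mulVf.
Qed.

Lemma is_ratfun2_pole k : is_ratfun2 (FracField.tofrac (fps_pole (x k))).
Proof.
rewrite tofrac_pole; apply/is_ratfun2V/is_ratfun2D; first exact: is_ratfun2_t.
by apply/is_ratfun2N; rewrite /carlitz_node -rmorphXn; apply: is_ratfun2_polyA.
Qed.

Variable pi : C.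
Hypothesis pi_neq0 : pi != 0.

(** For nonzero pi, membership in pi^n F_q(t, theta). *)
Definition weight n (f : fps C) : Prop :=
  is_ratfun2 (FracField.tofrac f / laurentC pi ^+ n).

Lemma weightN n f : weight n f -> weight n (- f).
Proof. by rewrite /weight tofracN mulNr; apply: is_ratfun2N. Qed.

Lemma weightD n f g : weight n f -> weight n g -> weight n (f + g).
Proof. by rewrite /weight tofracD mulrDl; apply: is_ratfun2D. Qed.

Lemma weightM m n f g : weight m f -> weight n g -> weight (m + n) (f * g).
Proof. by rewrite /weight tofracM exprD -mulf_div; apply: is_ratfun2M. Qed.

Lemma weight_sum n (I : Type) (r : seq I) (P : pred I) (F : I -> fps C) :
  (forall i, P i -> weight n (F i)) -> weight n (\sum_(i <- r | P i) F i).
Proof.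
move=> wF; elim/big_ind: _ => //; last exact: weightD.
by rewrite /weight tofrac0 mul0r -(rmorph0 ratfun2_poly); apply: is_ratfun2_poly.
Qed.

Lemma weight_pole k : weight 0 (fps_pole (x k)).
Proof. by rewrite /weight expr0 divr1; apply: is_ratfun2_pole. Qed.

(** Rationality holds because d_k lies in A. *)
Lemma weightC n k : weight n (fpsC (pi ^+ n / car_d C k)).
Proof.
have [a aE] := car_d_polyA C k; rewrite /weight -/(laurentC _) fmorph_div rmorphXn /=.
rewrite mulrAC divff ?expf_neq0 ?fmorph_eq0 // mul1r aE.
exact/is_ratfun2V/is_ratfun2_polyA.
Qed.

End Rationality.

(** * Passage to the limit in the recurrence *)

Section ValueLimits.
Variables (R : realType) (Fq : finFieldType) (C : Cinfty R Fq).
Local Notation q := #|Fq|.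
Local Notation abs := (@Cinf_abs R Fq C).
Local Notation "u ~~> l" := (fps_cvg abs u l) (at level 70).
Local Notation x := (carlitz_node (polyA C)).
Local Notation c := (carlitz_coef (polyA C)).

Let absP : absolute_value abs := @Cinf_abs_axiom R Fq C.

Section Period.
Variable rho : C.
Hypothesis hrho : rho ^+ q.-1 = - theta C.
Local Notation pi := (car_period rho).

Definition carlitz_limit j : C :=
  \sum_(k < j | (q ^ k == j)%N) pi ^+ (q ^ k).-1 / car_d C k.

Lemma carlitz_poly_cvg j :
  (fun d => fpsC (carlitz_poly (polyA C) d.+1)`_j) ~~> fpsC (carlitz_limit j).
Proof.
apply: fps_cvgC => //.
apply: (acvg_eventually absP (N := j)
  (v := fun d => \sum_(k < j | (q ^ k == j)%N) c d.+1 k)) => [d jd|].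
  by rewrite (coef_sum_qpow Fq d.+1 (c d.+1)) (ord_sum_qpow Fq (c d.+1)) // ltnW // ltnW.
apply: acvg_sum => // k _.
exact: (@acvg_shift _ _ _ absP (fun d => c d k) _ 1 (carlitz_coef_cvg hrho k)).
Qed.

(** A term is present only if q^k = j + 1, and then its power of pi is q^k - 1 = j. *)
Lemma weight_carlitz_limit j : weight pi j (fpsC (carlitz_limit j.+1)).
Proof.
rewrite rmorph_sum; apply: weight_sum => k /eqP qk; rewrite qk /=.
by apply: weightC; apply: period_neq0.
Qed.

Definition interp_limit m : fps C :=
  \sum_(k < m | (q ^ k == m)%N)
    fpsC (- (pi * (pi ^+ (q ^ k).-1 / car_d C k))) * fps_pole (x k).

Lemma interp_cvg m :
  (fun d => s_trunc rho d * interp_coef C d m) ~~> interp_limit m.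
Proof.
apply: (fps_cvg_eventually absP (N := m)
  (v := fun d => \sum_(k < m | (q ^ k == m)%N) fpsC (- (pi * c d k)) * fps_pole (x k))).
  move=> d md; rewrite s_trunc_interp.
  by rewrite (ord_sum_qpow Fq (fun k => fpsC (- (pi * c d k)) * fps_pole (x k))) // ltnW.
apply: fps_cvg_sum => // k _; apply: fps_cvgM => //; last exact: fps_cvg_cst.
apply: fps_cvgC => //; apply: acvgN => //; apply: acvgM => //; first exact: acvg_cst.
exact: carlitz_coef_cvg.
Qed.

Lemma weight_interp_limit m : weight pi m (interp_limit m).
Proof.
apply: weight_sum => k /eqP qk; rewrite -[X in weight _ X]addn0.
apply: weightM; last exact: weight_pole.
rewrite rmorphN; apply: weightN; rewrite mulrA period_expq qk.
by apply: weightC; apply: period_neq0.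
Qed.

(** Strong induction on the recurrence multiplied by [s_trunc]. It is homogeneous in the weight: (j
    + 1) + (m - j) = m + 1. *)
Lemma power_sum_cvg n : (0 < n)%N ->
  exists2 Lam, (fun d => s_trunc rho d * power_sum_fps C d.+1 n) ~~> Lam
             & weight pi n Lam.
Proof.
elim/ltn_ind: n => -[//|m] IH _.
have /choice[Lam LamP] : forall j : 'I_m, exists Lam,
    (fun d => s_trunc rho d * power_sum_fps C d.+1 (m - j)) ~~> Lam /\
    weight pi (m - j) Lam.
  move=> j; have [||Lam L1 L2] := IH (m - j)%N; last by exists Lam.
    by rewrite ltnS leq_subr.
  by rewrite subn_gt0.
exists (- interp_limit m.+1 - \sum_(j < m) fpsC (carlitz_limit j.+2) * Lam j).
  have -> : (fun d => s_trunc rho d * power_sum_fps C d.+1 m.+1) = fun d =>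
      - (s_trunc rho d * interp_coef C d m.+1) -
      \sum_(j < m) fpsC (carlitz_poly (polyA C) d.+1)`_j.+2 *
         (s_trunc rho d * power_sum_fps C d.+1 (m - j)).
    apply/funext => d; rewrite power_sum_fps_rec mulrBr mulrN mulr_sumr.
    by congr (_ - _); apply: eq_bigr => j _; rewrite mulrCA.
  apply: fps_cvgD => //; apply: fps_cvgN => //; first exact: interp_cvg.
  apply: fps_cvg_sum => // j _; apply: fps_cvgM => //; first exact: carlitz_poly_cvg.
  by have [] := LamP j.
apply: weightD; apply: weightN; first exact: weight_interp_limit.
apply: weight_sum => j _; have [_ wj] := LamP j.
have -> : m.+1 = (j.+1 + (m - j))%N by rewrite addSn subnKC // ltnW.
apply: weightM => //; exact: weight_carlitz_limit.
Qed.

(** For exponent 1 the recurrence has no further terms, so the product is pi / (t - theta) for every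
    d. This later shows that s_Car is nonzero. *)
Lemma power_sum1 d :
  s_trunc rho d * power_sum_fps C d.+1 1 = fpsC pi * fps_pole (x 0).
Proof.
rewrite power_sum_fps_rec big_ord0 subr0 mulrN s_trunc_interp.
rewrite (ord_sum_qpow Fq (fun k => fpsC (- (pi * c d k)) * fps_pole (x k))) //.
rewrite big_mkcond big_ord1 expn0 eqxx carlitz_coef0 ?mulr1; last exact: polyA_inj.
by rewrite rmorphN mulNr opprK.
Qed.

End Period.

Lemma coef_twist_le1 (a : {poly Fq}) i : abs (twist (polyA C) a)`_i <= 1.
Proof.
rewrite coef_map_id0 ?rmorph0 //; have [->|ai] := eqVneq a`_i 0.
  by rewrite rmorph0 av0.
by rewrite abs_polyA ?polyC_eq0 // size_polyC ai expr0.
Qed.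

Lemma chi_t_coef (a : {poly Fq}) n i :
  fps_coef (chi_t C a * fpsC (polyA C a ^- n)) i =
  (twist (polyA C) a)`_i / polyA C a ^+ n.
Proof. by rewrite mulrC fps_coefCM mulrC. Qed.

(* Sums over [a <> 0] split according to the leading coefficient, and for
   [n = 1 %[mod q - 1]] each of the [q - 1] parts gives the sum over monic [a]. *)
Lemma power_sum_monic d n i : (0 < n)%N -> n = 1 %[mod q.-1] ->
  power_sum (polyA C) d n i =
  - \sum_(a : {poly_d Fq} | (a : {poly Fq}) \is monic)
      (twist (polyA C) a)`_i / polyA C a ^+ n.
Proof.
move=> n0 n1; rewrite /power_sum.
pose F (a : {poly Fq}) := (twist (polyA C) a)`_i / polyA C a ^+ n.
have FZ b a : b != 0 -> F (b *: a) = F a.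
  (* Here b^n = b, since b^(q-1) = 1 and q - 1 divides n - 1. *)
  move=> b0; have bn : polyA C b%:P ^+ n = polyA C b%:P.
    have /dvdnP[k kE] : (q.-1 %| n - 1)%N by rewrite -eqn_mod_dvd // n1.
    rewrite -rmorphXn -polyC_exp; congr (polyA C _%:P).
    rewrite -(subnK n0) addn1 exprSr kE mulnC exprM.
    suff -> : b ^+ q.-1 = 1 by rewrite expr1n mul1r.
    apply: (mulIf b0); rewrite -exprSr prednK ?expf_card ?mul1r //.
    exact: ltnW (card_field_gt1 Fq).
  have pb0 : polyA C b%:P != 0.
    by rewrite -(rmorph0 (polyA C)) (inj_eq (@polyA_inj _ _ C)) polyC_eq0.
  rewrite /F -mul_polyC rmorphM /= exprMn bn.
  rewrite !coef_map_id0 ?rmorph0 // mul_polyC coefZ polyCM rmorphM /=.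
  by rewrite -mulf_div divff // mul1r.
rewrite -[LHS]/(\sum_(a : {poly_d Fq} | a != 0) F a).
rewrite -[X in - X]/(\sum_(a : {poly_d Fq} | (a : {poly Fq}) \is monic) F a).
rewrite (partition_big (fun a : {poly_d Fq} => lead_coef (a : {poly Fq}))
  (fun b => b != 0)) /=; last first.
  by move=> a; rewrite lead_coef_eq0.
rewrite (eq_bigr
  (fun=> \sum_(a : {poly_d Fq} | (a : {poly Fq}) \is monic) F a)) => [|b b0].
  (* There are q - 1 possible leading coefficients, and q - 1 = -1 in characteristic p. *)
  rewrite sumr_const cardC1 -mulr_natr -subn1 natrB ?(ltnW (card_field_gt1 Fq)) //.
  have := card_exp_natr (polyA C) (k := 1) isT; rewrite expn1 => ->.
  by rewrite sub0r mulrN1.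
rewrite (reindex_onto (fun a => b *: a) (fun a => b^-1 *: a)) /=; last first.
  by move=> a _; rewrite scalerA divff // scale1r.
apply: eq_big => [a|a _]; last exact: FZ.
rewrite scalerA mulVf // scale1r eqxx andbT scaler_eq0 (negPf b0) /=.
rewrite lead_coefZ monicE; apply/andP/eqP => [[_ /eqP]|a1].
  by rewrite -[RHS]mulr1 => /(mulfI b0).
split; last by rewrite a1 mulr1.
by apply: contra_eq_neq a1 => ->; rewrite lead_coef0 eq_sym oner_neq0.
Qed.

End ValueLimits.

(** * The L-series *)

Section LSeries.
Variables (R : realType) (Fq : finFieldType) (C : Cinfty R Fq).
Local Notation q := #|Fq|.
Local Notation abs := (@Cinf_abs R Fq C).
Local Notation monic_poly := {a : {poly Fq} | a \is monic}.

Let absP : absolute_value abs := @Cinf_abs_axiom R Fq C.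

(** The sum defining [L_chi_t] is indexed by the subtype of monic polynomials, so its exhaustion by
    degree must consist of finite sets of that subtype. *)
Definition monics d : {fset monic_poly} :=
  seq_fset tt (pmap insub [seq polyn a | a <- enum {poly_d Fq}]).

Lemma mem_monics d (a : monic_poly) : (a \in monics d) = (size (val a) <= d)%N.
Proof.
rewrite seq_fsetE mem_pmap_sub; apply/mapP/idP => [[b _ ->]|sza].
  exact: size_npoly.
by exists (npolyp d (val a)); rewrite ?mem_enum //= npolypK.
Qed.

Lemma sum_monics d (F : {poly Fq} -> C) :
  \sum_(a <- monics d) F (val a) =
  \sum_(a : {poly_d Fq} | (a : {poly Fq}) \is monic) F a.
Proof.
rewrite (perm_big (pmap insub [seq polyn a | a <- enum {poly_d Fq}])).
  rewrite big_pmap big_map big_enum [RHS]big_mkcond /=; apply: eq_bigr => a _.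
  by case: insubP => [b -> /= -> | /negPf ->].
apply: uniq_perm; first exact: fset_uniq.
  by rewrite pmap_sub_uniq // map_inj_uniq ?enum_uniq //; apply: val_inj.
by move=> a; rewrite seq_fsetE.
Qed.

Variables (n i : nat).
Hypothesis n_gt0 : (0 < n)%N.

Definition L_term (a : monic_poly) : C :=
  fps_coef (chi_t C (val a) * fpsC (polyA C (val a) ^- n)) i.

Lemma abs_L_term a : abs (L_term a) <= (q%:R ^+ (size (val a)).-1)^-1.
Proof.
have a0 : val a != 0 by apply: monic_neq0; apply: valP.
rewrite /L_term chi_t_coef (avM absP) (avV absP) (avX absP) abs_polyA //.
have q1 := cardR_gt1 R Fq; have q0 := lt_trans ltr01 q1.
apply: (le_trans (ler_piMl _ (coef_twist_le1 C (val a) i))).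
  by rewrite invr_ge0 !exprn_ge0 // ltW.
rewrite lef_pV2 ?posrE ?exprn_gt0 // ler_eXnr // exprn_ege1 //.
exact: ltW.
Qed.

(** A monic polynomial outside [monics d.+1] has degree > d, and its term is at most q^-d because n
    > 0. *)
Lemma L_sum_cvg :
  abs_cvg abs \oo (fun d => \sum_(a <- monics d.+1) L_term a)
    (fps_coef (L_chi_t C n) i).
Proof.
have [_ _ complete] := @Cinf_completion R Fq C.
have q0 := lt_trans ltr01 (cardR_gt1 R Fq).
apply: (acvg_abs_sum absP complete (M := fun d => (q%:R ^+ d)^-1)).
- by move=> d; apply/fsubsetP => a; rewrite !mem_monics => /leqW.
- move=> d a; rewrite mem_monics -ltnNge => sza; apply: (le_trans (abs_L_term a)).
  rewrite lef_pV2 ?posrE ?exprn_gt0 // ler_weXn2l ?(ltW (cardR_gt1 R Fq)) //.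
  by case: (size _) sza => //= s /ltnW.
- apply: (@vanishing_natr _ _ 1) => k.
  rewrite mulrC ler_pdivrMr ?exprn_gt0 // mul1r -natrX ler_nat ltnW //.
  by apply: ltn_expl; apply: card_field_gt1.
Qed.

End LSeries.

Lemma power_sum_L_cvg (R : realType) (Fq : finFieldType) (C : Cinfty R Fq) n :
    (0 < n)%N -> n = 1 %[mod #|Fq|.-1] ->
  fps_cvg (@Cinf_abs R Fq C) (fun d => power_sum_fps C d.+1 n) (- L_chi_t C n).
Proof.
move=> n0 n1 i; have absP := @Cinf_abs_axiom R Fq C.
rewrite fps_coefN.
have -> : (fun d => fps_coef (power_sum_fps C d.+1 n) i) =
    fun d => - \sum_(a <- monics Fq d.+1) L_term C n i a.
  apply/funext => d; rewrite /= power_sum_monic //.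
  rewrite -(sum_monics _ (fun a => (twist (polyA C) a)`_i / polyA C a ^+ n)).
  by congr (- _); apply: eq_bigr => a _; rewrite /L_term chi_t_coef.
by apply: acvgN => //; apply: L_sum_cvg.
Qed.

(** In the constant coefficient the term of a = 1 is 1 and dominates: every other monic a has
    positive degree, hence a term of absolute value < 1. *)
Lemma L_chi_t_neq0 (R : realType) (Fq : finFieldType) (C : Cinfty R Fq) n :
  (0 < n)%N -> L_chi_t C n != 0.
Proof.
move=> n0; have absP := @Cinf_abs_axiom R Fq C.
have q1 := cardR_gt1 R Fq; have q0 := lt_trans ltr01 q1.
suff : Cinf_abs (fps_coef (L_chi_t C n) 0) = 1.
  by apply: contra_eq_neq => ->; rewrite av0 // eq_sym oner_neq0.
apply: (acvg_av absP (L_sum_cvg C 0 n0) ltr01) => d.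
pose one : {a : {poly Fq} | a \is monic} := exist _ 1 (monic1 Fq).
rewrite (bigD1_seq one) ?fset_uniq ?mem_monics ?size_poly1 //.
have L1 : L_term C n 0 one = 1.
  by rewrite /L_term chi_t_coef coef_map_id0 ?rmorph0 // coef1 /= !rmorph1 expr1n divr1.
rewrite (avD_dominant absP) L1 (av1 absP) //; apply: av_sum_lt => // a a1.
apply: (le_lt_trans (abs_L_term C 0 n0 a)); rewrite invf_lt1 ?exprn_gt0 //.
rewrite exprn_egt1 // -lt0n -subn1 subn_gt0 ltnNge; apply: contra a1 => sza.
apply/eqP/val_inj => /=; have := valP a; rewrite monicE lead_coefE.
have -> : (size (val a)).-1 = 0%N by case: size sza => [|[]].
by rewrite [RHS](_ : _ = 1%:P) // [LHS](size1_polyC sza) => /eqP ->.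
Qed.

Theorem theorem3 (R : realType) (Fq : finFieldType) (C : Cinfty R Fq)
    (rho : C) (hrho : rho ^+ #|Fq|.-1 = - theta C)
    (alpha : nat) (alpha_gt0 : (0 < alpha)%N)
    (alpha_mod : alpha = 1 %[mod #|Fq|.-1]) :
  exists lambda : ratfun2 Fq, lambda != 0 /\
    laurent_of_fps (L_chi_t C alpha) =
      laurent_of_ratfun2 C lambda *
      (laurentC (car_period rho ^+ alpha) /
       ((laurent_t C - laurentC (theta C)) *
        laurent_of_fps (s_Car (car_period rho)))).
Proof.
have absP := @Cinf_abs_axiom R Fq C; have pi0 := period_neq0 hrho.
set pi := car_period rho in pi0 *; set s := s_Car pi.
have sL n : (0 < n)%N -> n = 1 %[mod #|Fq|.-1] ->
    fps_cvg (@Cinf_abs R Fq C) (fun d => s_trunc rho d * power_sum_fps C d.+1 n)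
      (- (s * L_chi_t C n)).
  move=> n0 n1; rewrite -mulrN; apply: fps_cvgM => //; first exact: s_trunc_cvg.
  exact: power_sum_L_cvg.
have t_theta0 : laurent_t C - laurentC (theta C) != 0.
  by rewrite theta_node -invr_eq0 -tofrac_pole tofrac_eq0 fps_pole_neq0 ?node_neq0.
(* The case of exponent 1 gives - s L(chi_t, 1) = pi / (t - theta), which is nonzero. *)
have s0 : s != 0.
  have := fps_cvg_unique absP (sL 1%N isT erefl).
  under [fun d => _]funext do rewrite power_sum1 //.
  move=> /(_ _ (fps_cvg_cst absP _)) sE.
  apply: contra_eq_neq sE => ->; rewrite mul0r oppr0 eq_sym mulf_neq0 //.
    by rewrite -(rmorph0 (@fpsC C)) (inj_eq (@fpsC_inj C)).
  by rewrite fps_pole_neq0 ?node_neq0.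
have [Lam LamP [lam lamE]] := power_sum_cvg hrho alpha_gt0.
have sLE := fps_cvg_unique absP (sL _ alpha_gt0 alpha_mod) LamP.
(* As [lam] maps to - s L(chi_t, alpha) / pi^alpha, solving for L gives the factor - (t - theta)
   [lam]. *)
have [mu muE] : is_ratfun2 ((laurent_t C - laurentC (theta C)) *
    - laurent_of_ratfun2 C lam).
  apply: is_ratfun2M; last by apply: is_ratfun2N; exists lam.
  apply: is_ratfun2D; first exact: is_ratfun2_t.
  by apply: is_ratfun2N; apply: is_ratfun2_polyA.
have LE : laurent_of_fps (L_chi_t C alpha) =
      laurent_of_ratfun2 C mu *
      (laurentC (pi ^+ alpha) /
       ((laurent_t C - laurentC (theta C)) * laurent_of_fps s)).
  have solve (F : fieldType) (a p u v : F) : a != 0 -> p != 0 -> u != 0 ->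
      v = a * - (- (u * v) / p) * (p / (a * u)).
    move=> a0 p0 u0; rewrite mulNr opprK !mulrA divfK // [a * u * v]mulrC.
    by rewrite -[RHS]mulrA divff ?mulr1 ?mulf_neq0.
  rewrite muE lamE -sLE tofracN tofracM rmorphXn.
  apply: (solve _ _ _ _ _ t_theta0); last by rewrite tofrac_eq0.
  by apply: expf_neq0; rewrite fmorph_eq0.
exists mu; split=> //.
(* If [mu] were 0, the formula would make L(chi_t, alpha) vanish. *)
have : laurent_of_fps (L_chi_t C alpha) != 0 by rewrite tofrac_eq0 L_chi_t_neq0.
apply: contraNneq => mu0; rewrite LE mu0.
by rewrite /laurent_of_ratfun2 (frac_map0 (@ratfun2_poly_inj _ _ C)) mul0r.
Qed.
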